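(* Let $A$ be a finite dimensional weak $C^*$-Hopf algebra with dual $\hat A$, and let $l\in\mathcal L(A)$ and $\lambda\in\mathcal L(\hat A)$ be a dual pair of nondegenerate left integrals. Denote $E_l:\hat A\ni\varphi\mapsto(l\rightharpoonup\varphi)\in\hat A_L$ and $\hat E_\lambda:A\ni a\mapsto(\lambda\rightharpoonup a)\in A_L$. Then: (i) $E_l$ is of index-finite type with quasi-basis $\sum_iu_i\otimes v_i=\lambda_{(2)}\otimes\hat S^{-1}(\lambda_{(1)})$. (ii) $\hat E_\lambda$ is of index-finite type with quasi-basis $\sum_iu_i\otimes v_i=l_{(2)}\otimes S^{-1}(l_{(1)})$. (iii) $\mathrm{Ind}\,l=\lambda_{(2)}\hat S^{-1}(\lambda_{(1)})\equiv n_R(\lambda)\in\hat A_R\cap C(\hat A)$ and $\mathrm{Ind}\,\lambda=l_{(2)}S^{-1}(l_{(1)})\equiv n_R(l)\in A_R\cap C(A)$. (iv) Assume $l$ is normalized and $\mathrm{Ind}\,l$ is invertible. If $\mathrm{Ind}\,l\in\hat{\mathcal Z}:=\hat A_L\cap\hat A_R\cap C(\hat A)$, then the normalized left integral $\dot\lambda=n_R(\lambda)^{-1}\lambda$ satisfies $$\hat E_\lambda=(\mathrm{Ind}\,\dot\lambda)\,\hat E_{\dot\lambda}.$$ In this case $\mathrm{Ind}\,\dot\lambda\in\mathcal Z:=A_L\cap A_R\cap C(A)$ and under the natural isomorphism $\mathcal Z\cong\hat{\mathcal Z}$ these indices coincide, i.e. for $\sigma=L,R$ $$\mathrm{Ind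}\,\dot\lambda=\hat\varepsilon_\sigma(\mathrm{Ind}\,l),\qquad\mathrm{Ind}\,l=\varepsilon_\sigma(\mathrm{Ind}\,\dot\lambda).$$
   Context: A finite dimensional weak $C^*$-Hopf algebra is a finite dimensional $C^*$-algebra $A$ (unit $1$) with linear maps $\Delta:A\to A\otimes A$, $\varepsilon:A\to\mathbb C$, $S:A\to A$ such that, for all $x,y,z\in A$ in Sweedler notation: $\Delta(xy)=\Delta(x)\Delta(y)$; $\Delta(x^* )=\Delta(x)^*$; $(\Delta\otimes\mathrm{id})\Delta=(\mathrm{id}\otimes\Delta)\Delta$; $(\Delta(1)\otimes1)(1\otimes\Delta(1))=1_{(1)}\otimes1_{(2)}\otimes1_{(3)}$; $(\varepsilon\otimes\mathrm{id})\Delta=\mathrm{id}=(\mathrm{id}\otimes\varepsilon)\Delta$; $\varepsilon(xyz)=\varepsilon(xy_{(1)})\varepsilon(y_{(2)}z)$; $S(x_{(1)})x_{(2)}=1_{(1)}\varepsilon(x1_{(2)})$; $x_{(1)}S(x_{(2)})=\varepsilon(1_{(1)}x)1_{(2)}$; $S(x_{(1)})x_{(2)}S(x_{(3)})=S(x)$. ($\Delta(1)\neq 1\otimes 1$ in general; $S$ is automatically invertible.) Put $x_*:=S(x)^*$. The dual $\hat A$ is the dual vector space with $\langle\psi\varphi|x\rangle=\langle\psi\otimes\varphi|\Delta(x)\rangle$, $\langle\hat\Delta(\psi)|x\otimes y\rangle=\langle\psi|xy\rangle$, $\hat1=\varepsilon$, $\hat\varepsilon(\psi)=\langle\psi|1\rangle$,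 $\langle\hat S(\psi)|x\rangle=\langle\psi|S(x)\rangle$, $\langle\psi^*|x\rangle=\overline{\langle\psi|x_*\rangle}$; it is again a finite dimensional weak $C^*$-Hopf algebra, with dual $A$. Write $\langle a\rightharpoonup\varphi|b\rangle=\langle\varphi|ba\rangle$, $\langle\varphi\leftharpoonup a|b\rangle=\langle\varphi|ab\rangle$, $\varphi\rightharpoonup a=a_{(1)}\langle\varphi|a_{(2)}\rangle$, $a\leftharpoonup\varphi=\langle\varphi|a_{(1)}\rangle a_{(2)}$. Put $\varepsilon_R(a)=a\rightharpoonup\hat1$, $\varepsilon_L(a)=\hat1\leftharpoonup a$, $\hat\varepsilon_R(\varphi)=\varphi\rightharpoonup1$, $\hat\varepsilon_L(\varphi)=1\leftharpoonup\varphi$, and $\hat A_\sigma=\varepsilon_\sigma(A)$, $A_\sigma=\hat\varepsilon_\sigma(\hat A)$ for $\sigma=L,R$. $C(\cdot)$ is the center. Integrals (equally for $\hat A$): $l\in\mathcal L(A)$ (left integral) iff $al=a_{(1)}S(a_{(2)})l$ for all $a$. $l$ is nondegenerate if $(\varphi,\psi)\mapsto\langle l|\varphi\psi\rangle$ is nondegenerate on $\hat A$; normalized if $l\rightharpoonup\hat1=\hat1$. $l$ and $\lambda\in\mathcal L(\hat A)$ are dual if $\lambda\rightharpoonup l=1$ (equivalently $l\rightharpoonup\lambda=\hat1$). $n_R(l)=l_{(2)}S^{-1}(l_{(1)})$, $n_R(\lambda)=\lambda_{(2)}\hat S^{-1}(\lambda_{(1)})$. A map $E:B\to D\subset B$ is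 of index-finite type if there is a finite quasi-basis $u_i,v_i\in B$ with $\sum_iu_iE(v_ib)=b=\sum_iE(bu_i)v_i$ for all $b\in B$; its (Watatani) index is $\mathrm{Ind}\,E=\sum_iu_iv_i$. For nondegenerate $l\in\mathcal L(A)$, $\mathrm{Ind}\,l:=\mathrm{Ind}\,E_l$, and for nondegenerate $\lambda\in\mathcal L(\hat A)$, $\mathrm{Ind}\,\lambda:=\mathrm{Ind}\,\hat E_\lambda$. *)

(* Defs.v *)
From HB Require Import structures.
From mathcomp Require Import all_boot all_order all_algebra all_field.
From mathcomp Require Import boolp classical_sets reals complex.

Set Implicit Arguments.
Unset Strict Implicit.
Unset Printing Implicit Defensive.

Import Order.TTheory GRing.Theory Num.Theory.
Local Open Scope ring_scope.

(* U ⊗ V as matrices of coordinates in the fixed bases vbasis {:U}, vbasis {:V};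
   tlift_pure, tlift_linear and tens_ext are its universal property. *)
Definition tens (K : fieldType) (U V : vectType K) : Type :=
  'M[K]_(\dim {:U}, \dim {:V}).

HB.instance Definition _ (K : fieldType) (U V : vectType K) :=
  Vector.copy (tens U V) 'M[K]_(\dim {:U}, \dim {:V}).

Lemma linear_sumZ (K : fieldType) (U W : lmodType K) (F : U -> W)
    (I : Type) (r : seq I) (a : I -> K) (u : I -> U) :
  linear F -> F (\sum_(i <- r) a i *: u i) = \sum_(i <- r) a i *: F (u i).
Proof.
move=> lF; have F0 : F 0 = 0.
  by have := lF (-1) 0 0; rewrite !scaleN1r !addNr.
by elim: r => [|i r IH]; rewrite ?big_nil ?big_cons // lF IH.
Qed.

Lemma linear_sum1 (K : fieldType) (U W : lmodType K) (F : U -> W)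
    (I : Type) (r : seq I) (u : I -> U) :
  linear F -> F (\sum_(i <- r) u i) = \sum_(i <- r) F (u i).
Proof.
move=> lF; have := linear_sumZ r (fun=> 1) u lF.
under eq_bigr do rewrite scale1r; move=> ->.
by apply: eq_bigr => i _; rewrite scale1r.
Qed.

Lemma linear_scale (K : fieldType) (U W : lmodType K) (F : U -> W) a u :
  linear F -> F (a *: u) = a *: F u.
Proof.
move=> lF; have := linear_sumZ [:: tt] (fun=> a) (fun=> u) lF.
by rewrite !big_seq1.
Qed.

Section Tens.
Variables (K : fieldType) (U V : vectType K).

Definition tpure (u : U) (v : V) : tens U V :=
  \matrix_(i, j) (coord (vbasis {:U}) i u * coord (vbasis {:V}) j v).

Definition tcoef (t : tens U V) i j : K := (t : 'M[K]_(_, _)) i j.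

(* The linear map U ⊗ V -> W induced by f, i.e. the Sweedler-notation sum
   f(t_(1), t_(2)). Only meaningful for bilinear f. *)
Definition tlift (W : lmodType K) (f : U -> V -> W) (t : tens U V) : W :=
  \sum_i \sum_j tcoef t i j *: f (vbasis {:U})`_i (vbasis {:V})`_j.

Definition bilin (W : lmodType K) (f : U -> V -> W) : Prop :=
  (forall v, linear (f^~ v)) /\ (forall u, linear (f u)).

Lemma tcoef_linear a (s t : tens U V) i j :
  tcoef (a *: s + t) i j = a * tcoef s i j + tcoef t i j.
Proof. by rewrite /tcoef !mxE. Qed.

Lemma tlift_linear (W : lmodType K) (f : U -> V -> W) : linear (tlift f).
Proof.
move=> a s t; rewrite /tlift scaler_sumr -big_split; apply: eq_bigr => i _ /=.
rewrite scaler_sumr -big_split; apply: eq_bigr => j _ /=.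
by rewrite tcoef_linear scalerDl scalerA.
Qed.

Lemma tlift_pure (W : lmodType K) (f : U -> V -> W) u v :
  bilin f -> tlift f (tpure u v) = f u v.
Proof.
case=> fl fr; rewrite [in RHS](coord_vbasis (memvf u)).
rewrite (linear_sumZ _ _ _ (fl v)); apply: eq_bigr => i _.
rewrite [in RHS](coord_vbasis (memvf v)) (linear_sumZ _ _ _ (fr _)).
rewrite scaler_sumr; apply: eq_bigr => j _.
by rewrite scalerA /tcoef mxE.
Qed.

Lemma tpure_bilin : bilin tpure.
Proof.
split=> w a s t; apply/matrixP=> i j; rewrite !mxE linearP /=.
  by rewrite mulrDl mulrA.
by rewrite mulrDr mulrCA.
Qed.

Lemma tlift_id t : tlift tpure t = t.
Proof.
apply/matrixP=> i j; rewrite summxE (bigD1 i) //= summxE (bigD1 j) //=.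
rewrite !mxE !coord_free ?(basis_free (vbasisP _)) // !eqxx !mulr1.
rewrite big1 => [|k /negPf nkj]; last first.
  by rewrite !mxE !coord_free ?(basis_free (vbasisP _)) // [k == j]nkj !mulr0.
rewrite addr0 big1 ?addr0 // => k nki; rewrite summxE big1 // => l _.
rewrite !mxE !coord_free ?(basis_free (vbasisP _)) // [_ == i](negPf nki).
by rewrite mul0r mulr0.
Qed.

Lemma tens_ext (W : lmodType K) (F G : tens U V -> W) :
  linear F -> linear G -> (forall u v, F (tpure u v) = G (tpure u v)) ->
  F =1 G.
Proof.
move=> lF lG FG t; rewrite -(tlift_id t) /tlift.
rewrite (linear_sum1 _ _ lF) (linear_sum1 _ _ lG).
apply: eq_bigr => i _; rewrite (linear_sumZ _ _ _ lF) (linear_sumZ _ _ _ lG).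
by apply: eq_bigr => j _; rewrite FG.
Qed.

Lemma eq_tlift (W : lmodType K) (f g : U -> V -> W) t :
  f =2 g -> tlift f t = tlift g t.
Proof. by move=> fg; do 2!apply: eq_bigr => ? _; rewrite fg. Qed.

Lemma tlift_linear_fun (W : lmodType K) (h f g : U -> V -> W) a t :
  (forall u v, h u v = a *: f u v + g u v) ->
  tlift h t = a *: tlift f t + tlift g t.
Proof.
move=> hE; rewrite /tlift scaler_sumr -big_split; apply: eq_bigr => i _ /=.
rewrite scaler_sumr -big_split; apply: eq_bigr => j _ /=.
by rewrite hE scalerDr !scalerA mulrC.
Qed.

End Tens.

HB.instance Definition _ (K : fieldType) (U V : vectType K) (W : lmodType K)
  (f : U -> V -> W) :=
  GRing.isLinear.Build K (tens U V) W *:%R (tlift f) (tlift_linear f).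

Notation "u ⊗ v" := (tpure u v) (at level 39, left associativity) : ring_scope.

Section TensAlgebra.
Variables (K : fieldType) (A B : falgType K).
Local Notation T := (tens A B).

Definition tone : T := 1 ⊗ 1.
Definition tmul (s t : T) : T :=
  tlift (fun a b => tlift (fun c d => (a * c) ⊗ (b * d)) t) s.

Let puL (b : B) : linear (fun a : A => a ⊗ b).
Proof. exact: (tpure_bilin A B).1. Qed.
Let puR (a : A) : linear (fun b : B => a ⊗ b).
Proof. exact: (tpure_bilin A B).2. Qed.

Let tmulL (t : T) : linear (tmul^~ t). Proof. exact: tlift_linear. Qed.

Let tmulR (s : T) : linear (tmul s).
Proof. by move=> a t u; apply: tlift_linear_fun => x y; apply: tlift_linear. Qed.

Lemma tmul_pure a b c d : tmul (a ⊗ b) (c ⊗ d) = (a * c) ⊗ (b * d).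
Proof.
have bl x y : bilin (fun (u : A) (v : B) => (x * u) ⊗ (y * v)).
  by split=> w k u v; rewrite mulrDr -scalerAr ?puL ?puR.
rewrite /tmul tlift_pure ?tlift_pure //; split=> w k u v.
  by apply: tlift_linear_fun => x y; rewrite mulrDl -scalerAl puL.
by apply: tlift_linear_fun => x y; rewrite mulrDl -scalerAl puR.
Qed.

Let tmulDl : left_distributive tmul +%R.
Proof. by move=> s t u; have := tmulL u 1 s t; rewrite !scale1r. Qed.

Let tmulDr : right_distributive tmul +%R.
Proof. by move=> s t u; have := tmulR s 1 t u; rewrite !scale1r. Qed.

Let tmulA : associative tmul.
Proof.
move=> s t u; apply: (tens_ext (F := fun s => tmul s (tmul t u))
  (G := fun s => tmul (tmul s t) u)) s => [k s s'|k s s'|a b] /=; rewrite ?tmulL //.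
apply: (tens_ext (F := fun t => tmul (a ⊗ b) (tmul t u))
  (G := fun t => tmul (tmul (a ⊗ b) t) u)) t => [k s s'|k s s'|c d] /=;
  rewrite ?(tmulL, tmulR) //.
apply: (tens_ext (F := fun u => tmul (a ⊗ b) (tmul (c ⊗ d) u))
  (G := tmul (tmul (a ⊗ b) (c ⊗ d)))) u => [k s s'|k s s'|e f] /=;
  rewrite ?tmulR //.
by rewrite !tmul_pure !mulrA.
Qed.

Let tmul1l : left_id tone tmul.
Proof.
move=> s; apply: (tens_ext (F := tmul tone) (G := id)) s => //= a b.
by rewrite tmul_pure !mul1r.
Qed.

Let tmul1r : right_id tone tmul.
Proof.
move=> s; apply: (tens_ext (F := tmul^~ tone) (G := id)) s => //= a b.
by rewrite tmul_pure !mulr1.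
Qed.

Let tone_neq0 : tone != 0.
Proof.
have nz (E : falgType K) : exists i, coord (vbasis {:E}) i 1 != 0.
  apply/existsP; apply: contraT; rewrite negb_exists => /forallP E0.
  have := oner_neq0 E; rewrite (coord_vbasis (memvf (1 : E))) big1 ?eqxx // => i _.
  by have := E0 i; rewrite negbK => /eqP ->; rewrite scale0r.
have [[i ni] [j nj]] := (nz A, nz B).
apply/eqP => /matrixP/(_ i j); rewrite !mxE => /eqP.
by rewrite mulf_eq0 (negPf ni) (negPf nj).
Qed.

HB.instance Definition _ := GRing.Zmodule_isNzRing.Build T
  tmulA tmul1l tmul1r tmulDl tmulDr tone_neq0.

Let tscalerAl (k : K) (s t : T) : k *: (s * t) = (k *: s) * t.
Proof. by have := tmulL t k s 0; rewrite addr0 (mul0r t : tmul 0 t = 0) addr0. Qed.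

HB.instance Definition _ := GRing.Lmodule_isLalgebra.Build K T tscalerAl.

Let tscalerAr (k : K) (s t : T) : k *: (s * t) = s * (k *: t).
Proof. by have := tmulR s k t 0; rewrite addr0 (mulr0 s : tmul s 0 = 0) addr0. Qed.

HB.instance Definition _ := GRing.Lalgebra_isAlgebra.Build K T tscalerAr.
HB.instance Definition _ := Algebra_isFalgebra.Build K T.

Lemma tens_mulE (a c : A) (b d : B) :
  (a ⊗ b) * (c ⊗ d) = (a * c) ⊗ (b * d) :> tens A B.
Proof. exact: tmul_pure. Qed.

End TensAlgebra.

Section TensMaps.
Variables (K : fieldType).

Definition tmap (U V U' V' : vectType K) (f : 'Hom(U, U')) (g : 'Hom(V, V')) :
  'Hom(tens U V, tens U' V') := linfun (tlift (fun u v => f u ⊗ g v)).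

Definition tassoc (U V W : vectType K) :
  'Hom(tens U (tens V W), tens (tens U V) W) :=
  linfun (tlift (fun u => tlift (fun v w => u ⊗ v ⊗ w))).

End TensMaps.

Lemma lin_tlift (K : fieldType) (U V : vectType K) (W W' : lmodType K)
    (F : W -> W') (f : U -> V -> W) t :
  linear F -> F (tlift f t) = tlift (fun u v => F (f u v)) t.
Proof.
move=> lF; rewrite /tlift (linear_sum1 _ _ lF); apply: eq_bigr => i _.
by rewrite (linear_sumZ _ _ _ lF).
Qed.

Lemma tlift_tmap (K : fieldType) (U V U' V' : vectType K) (W : lmodType K)
    (g : 'Hom(U, U')) (h : 'Hom(V, V')) (f : U' -> V' -> W) t :
  bilin f -> tlift f (tmap g h t) = tlift (fun u v => f (g u) (h v)) t.
Proof.
move=> bf; rewrite lfunE (lin_tlift _ _ (tlift_linear f)).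
by apply: eq_tlift => u v; rewrite tlift_pure.
Qed.

Lemma tassoc_pure (K : fieldType) (U V W : vectType K) u v w :
  tassoc U V W (u ⊗ (v ⊗ w)) = u ⊗ v ⊗ w.
Proof.
have puL (X Y : vectType K) (y : Y) : linear (fun x : X => x ⊗ y).
  exact: (tpure_bilin X Y).1.
have puR (X Y : vectType K) (x : X) : linear (fun y : Y => x ⊗ y).
  exact: (tpure_bilin X Y).2.
rewrite lfunE /= !tlift_pure //; split=> [y|x] k a b; rewrite ?puL ?puR ?puL //.
  by apply: tlift_linear_fun => c d; rewrite !puL.
exact: tlift_linear.
Qed.

Lemma tlift_tassoc (K : fieldType) (U V W : vectType K) (X : lmodType K)
    (f : tens U V -> W -> X) t :
  bilin f -> tlift f (tassoc U V W t) =
  tlift (fun u => tlift (fun v w => f (u ⊗ v) w)) t.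
Proof.
move=> bf; rewrite lfunE /= (lin_tlift _ _ (tlift_linear f)).
apply: eq_tlift => u y; rewrite (lin_tlift _ _ (tlift_linear f)).
by apply: eq_tlift => v w; rewrite tlift_pure.
Qed.

(* A finite-dimensional unital algebra that is also a coalgebra, with a linear
   endomorphism S and an antilinear map star. No compatibility is required
   here; this is the level at which the dual is again an object. *)
HB.mixin Record isPreHopf (K : numClosedFieldType) A of Falgebra K A := {
  comul : 'Hom(A, tens A A);
  counit : 'Hom(A, K^o);
  antipode : 'End(A);
  star : A -> A;
  comul_coassoc : forall x : A,
    tmap comul \1 (comul x) = tassoc A A A (tmap \1 comul (comul x));
  counitl : forall x : A,
    tlift (fun a b => (counit a : K) *: b) (comul x) = x;
  counitr : forall x : A,
    tlift (fun a b => (counit b : K) *: a) (comul x) = x;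
  star_antilinear : forall (c : K) (x y : A),
    star (c *: x + y) = c^* *: star x + star y
}.

#[short(type="preHopfType")]
HB.structure Definition PreHopf (K : numClosedFieldType) :=
  { A of Falgebra K A & isPreHopf K A }.

Arguments comul {K A} : rename.
Arguments counit {K A} : rename.
Arguments antipode {K A} : rename.
Arguments star {K A} : rename.

Definition antipode_inv (K : numClosedFieldType) (A : preHopfType K) :
  'End(A) := (antipode^-1)%VF.

(* the antilinear extension of a ⊗ b |-> a^* ⊗ b^*, hence not a tlift *)
Definition tstar (K : numClosedFieldType) (A : preHopfType K) (t : tens A A) :
  tens A A := \sum_i \sum_j
    (tcoef t i j)^* *: (star (vbasis {:A})`_i ⊗ star (vbasis {:A})`_j).

Lemma star_sumZ (K : numClosedFieldType) (A : preHopfType K)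
    (I : Type) (r : seq I) (c : I -> K) (u : I -> A) :
  star (\sum_(i <- r) c i *: u i) = \sum_(i <- r) (c i)^* *: star (u i).
Proof.
have s0 : star (0 : A) = 0.
  have := star_antilinear (-1) (0 : A) 0.
  by rewrite rmorphN1 !scaleN1r !addNr.
by elim: r => [|i r IH]; rewrite ?big_nil ?big_cons // star_antilinear IH.
Qed.

Lemma tstar_pure (K : numClosedFieldType) (A : preHopfType K) (a b : A) :
  tstar (a ⊗ b) = star a ⊗ star b.
Proof.
rewrite [in RHS](coord_vbasis (memvf a)) [in RHS](coord_vbasis (memvf b)).
rewrite !star_sumZ.
rewrite (linear_sumZ _ _ _ ((tpure_bilin A A).1 _)); apply: eq_bigr => i _ /=.
rewrite (linear_sumZ _ _ _ ((tpure_bilin A A).2 _)) scaler_sumr.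
by apply: eq_bigr => j _; rewrite scalerA /tcoef mxE rmorphM.
Qed.

Definition dual (K : fieldType) (V : vectType K) : Type := 'Hom(V, K^o).

HB.instance Definition _ (K : fieldType) (V : vectType K) :=
  Vector.copy (dual V) 'Hom(V, K^o).

Definition dpair (K : fieldType) (V : vectType K) (phi : dual V) (x : V) : K :=
  (phi : 'Hom(V, K^o)) x.

Notation "⟨ phi | x ⟩" := (dpair phi x)
  (at level 0, phi at level 69, x at level 69) : ring_scope.

Section DualVect.
Variables (K : fieldType) (V : vectType K).

Lemma dualP (phi psi : dual V) :
  (forall x, ⟨phi|x⟩ = ⟨psi|x⟩) -> phi = psi.
Proof. by move=> E; apply/lfunP. Qed.

Lemma dpair_linr (phi : dual V) : linear (dpair phi : V -> K^o).
Proof. by move=> a x y; rewrite /dpair linearP. Qed.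

Lemma dpair_linl (x : V) : linear (fun phi : dual V => ⟨phi|x⟩ : K^o).
Proof. by move=> a p q; rewrite /dpair add_lfunE scale_lfunE. Qed.

(* the basis of the dual space that is dual to vbasis {:V} *)
Definition dcoord (i : 'I_(\dim {:V})) : dual V :=
  linfun (coord (vbasis {:V}) i : V -> K^o).

Lemma dcoordE i x : ⟨dcoord i|x⟩ = coord (vbasis {:V}) i x.
Proof. by rewrite /dpair lfunE. Qed.

Lemma dual_coord (phi : dual V) :
  phi = \sum_(i < \dim {:V}) ⟨phi|(vbasis {:V})`_i⟩ *: dcoord i.
Proof.
apply: dualP => x; rewrite [in LHS](coord_vbasis (memvf x)).
rewrite (linear_sumZ _ _ _ (dpair_linr phi)).
rewrite (linear_sumZ _ _ _ (dpair_linl x)).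
by apply: eq_bigr => i _; rewrite dcoordE; apply: mulrC.
Qed.

Variable (W : vectType K).

Definition rcontr (x : V) : tens W (dual V) -> W :=
  tlift (fun w phi => ⟨phi|x⟩ *: w).

Let puL (b : dual V) : linear (fun a : W => a ⊗ b).
Proof. exact: (tpure_bilin W (dual V)).1. Qed.
Let puR (a : W) : linear (fun b : dual V => a ⊗ b).
Proof. exact: (tpure_bilin W (dual V)).2. Qed.

Lemma rcontr_bilin (x : V) :
  bilin (fun (w : W) (phi : dual V) => ⟨phi|x⟩ *: w).
Proof.
split=> [phi|w] a u v /=; first by rewrite scalerDr !scalerA mulrC.
have -> : ⟨a *: u + v|x⟩ = a * ⟨u|x⟩ + ⟨v|x⟩ := dpair_linl x a u v.
by rewrite scalerDl scalerA.
Qed.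

Lemma rcontr_inj (s t : tens W (dual V)) :
  (forall x, rcontr x s = rcontr x t) -> s = t.
Proof.
suff E r : r = \sum_(i < \dim {:V}) rcontr (vbasis {:V})`_i r ⊗ dcoord i.
  by move=> st; rewrite (E s) (E t); apply: eq_bigr => i _; rewrite st.
move: r; apply: tens_ext => // [a u v|w phi].
  rewrite scaler_sumr -big_split; apply: eq_bigr => i _ /=.
  by rewrite [rcontr _ (_ + _)]tlift_linear puL.
rewrite [in LHS](dual_coord phi) (linear_sumZ _ _ _ (puR w)).
apply: eq_bigr => i _; rewrite /rcontr tlift_pure; last exact: rcontr_bilin.
by rewrite (linear_scale _ _ (puL (dcoord i))).
Qed.

End DualVect.

Section DualAlgebra.
Variables (K : numClosedFieldType) (A : preHopfType K).
Implicit Types (phi psi chi : dual A) (x y : A).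

Definition dmul phi psi : dual A :=
  linfun (tlift (W := K^o) (fun a b => ⟨phi|a⟩ * ⟨psi|b⟩) \o comul).
Definition done : dual A := counit.

Lemma dmulE phi psi x :
  ⟨dmul phi psi|x⟩ = tlift (W := K^o) (fun a b => ⟨phi|a⟩ * ⟨psi|b⟩) (comul x).
Proof. by rewrite /dpair lfunE. Qed.

Lemma dpair2_bilin phi psi :
  bilin (fun a b => ⟨phi|a⟩ * ⟨psi|b⟩ : K^o).
Proof.
split=> c k u v /=.
  have -> : ⟨phi|k *: u + v⟩ = k * ⟨phi|u⟩ + ⟨phi|v⟩ := dpair_linr phi k u v.
  by rewrite mulrDl -mulrA.
have -> : ⟨psi|k *: u + v⟩ = k * ⟨psi|u⟩ + ⟨psi|v⟩ := dpair_linr psi k u v.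
by rewrite mulrDr mulrCA.
Qed.

Let dmulL psi : linear (dmul^~ psi).
Proof.
move=> k p q; apply: dualP => x.
have -> : ⟨k *: dmul p psi + dmul q psi|x⟩ =
  k * ⟨dmul p psi|x⟩ + ⟨dmul q psi|x⟩ := dpair_linl x k _ _.
rewrite !dmulE; apply: (tlift_linear_fun (W := K^o) (a := k)) => u v.
have -> : ⟨k *: p + q|u⟩ = k * ⟨p|u⟩ + ⟨q|u⟩ := dpair_linl u k p q.
by rewrite mulrDl -mulrA.
Qed.

Let dmulR psi : linear (dmul psi).
Proof.
move=> k p q; apply: dualP => x.
have -> : ⟨k *: dmul psi p + dmul psi q|x⟩ =
  k * ⟨dmul psi p|x⟩ + ⟨dmul psi q|x⟩ := dpair_linl x k _ _.
rewrite !dmulE; apply: (tlift_linear_fun (W := K^o) (a := k)) => u v.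
have -> : ⟨k *: p + q|v⟩ = k * ⟨p|v⟩ + ⟨q|v⟩ := dpair_linl v k p q.
by rewrite mulrDr mulrCA.
Qed.

Let dmulA : associative dmul.
Proof.
move=> phi psi chi; apply: dualP => x; rewrite !dmulE.
pose f (t : tens A A) (c : A) : K^o :=
  tlift (W := K^o) (fun a b => ⟨phi|a⟩ * ⟨psi|b⟩) t * ⟨chi|c⟩.
have bf : bilin f.
  split=> c k u v; rewrite /f.
    by rewrite tlift_linear mulrDl -mulrA.
  have -> : ⟨chi|k *: u + v⟩ = k * ⟨chi|u⟩ + ⟨chi|v⟩ := dpair_linr chi k u v.
  by rewrite mulrDr mulrCA.
transitivity (tlift f (tmap comul \1 (comul x))); last first.
  by rewrite tlift_tmap //; apply: (eq_tlift (W := K^o)) => a b; rewrite /f id_lfunE dmulE.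
rewrite comul_coassoc tlift_tassoc // tlift_tmap; last first.
  split=> c k u v /=.
    apply: tlift_linear_fun => a b; rewrite (tpure_bilin _ _).1.
    exact: (bf.1 b).
  exact: tlift_linear.
apply: (eq_tlift (W := K^o)) => a b; rewrite id_lfunE dmulE.
have lF : linear (fun z : K^o => ⟨phi|a⟩ * z : K^o).
  by move=> k u v; rewrite mulrDr mulrCA.
rewrite (lin_tlift _ _ lF); apply: (eq_tlift (W := K^o)) => c d; rewrite /f tlift_pure.
  by rewrite mulrA.
exact: dpair2_bilin.
Qed.

Let dmul1l : left_id done dmul.
Proof.
move=> phi; apply: dualP => x; rewrite dmulE -[in RHS](counitl x).
by rewrite (lin_tlift _ _ (dpair_linr phi)); apply: (eq_tlift (W := K^o)) => a b;
   rewrite (linear_scale _ _ (dpair_linr phi)).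
Qed.

Let dmul1r : right_id done dmul.
Proof.
move=> phi; apply: dualP => x; rewrite dmulE -[in RHS](counitr x).
by rewrite (lin_tlift _ _ (dpair_linr phi)); apply: (eq_tlift (W := K^o)) => a b;
   rewrite (linear_scale _ _ (dpair_linr phi)) mulrC.
Qed.

Let dmulDl : left_distributive dmul +%R.
Proof. by move=> s t u; have := dmulL u 1 s t; rewrite !scale1r. Qed.

Let dmulDr : right_distributive dmul +%R.
Proof. by move=> s t u; have := dmulR s 1 t u; rewrite !scale1r. Qed.

Let done_neq0 : done != 0.
Proof.
apply/eqP => d0; have := oner_neq0 A; rewrite -(counitl (1 : A)).
suff -> : tlift (fun a b : A => (counit a : K) *: b) (comul 1) = 0.
  by rewrite eqxx.
rewrite /tlift big1 // => i _; rewrite big1 // => j _.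
by rewrite (_ : counit = 0) // zero_lfunE scale0r scaler0.
Qed.

HB.instance Definition _ := GRing.Zmodule_isNzRing.Build (dual A)
  dmulA dmul1l dmul1r dmulDl dmulDr done_neq0.

Let dscalerAl (k : K) phi psi : k *: (phi * psi) = (k *: phi) * psi.
Proof. by rewrite -(linear_scale _ _ (dmulL psi)). Qed.
HB.instance Definition _ := GRing.Lmodule_isLalgebra.Build K (dual A) dscalerAl.

Let dscalerAr (k : K) phi psi : k *: (phi * psi) = phi * (k *: psi).
Proof. by rewrite -(linear_scale _ _ (dmulR phi)). Qed.
HB.instance Definition _ := GRing.Lalgebra_isAlgebra.Build K (dual A) dscalerAr.
HB.instance Definition _ := Algebra_isFalgebra.Build K (dual A).

Lemma dual_mulE phi psi x :
  ⟨phi * psi|x⟩ = tlift (W := K^o) (fun a b => ⟨phi|a⟩ * ⟨psi|b⟩) (comul x).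
Proof. exact: dmulE. Qed.

Lemma dual_oneE x : ⟨1|x⟩ = counit x.
Proof. by []. Qed.

End DualAlgebra.

Section DualCoalgebra.
Variables (K : numClosedFieldType) (A : preHopfType K).
Implicit Types (phi psi chi : dual A) (x y : A).
Local Notation e i := (vbasis {:A})`_i.

Definition dcomul_fun psi : tens (dual A) (dual A) :=
  \sum_(i < \dim {:A}) \sum_(j < \dim {:A})
    ⟨psi|e i * e j⟩ *: (dcoord i ⊗ dcoord j).

Lemma dcomul_linear : linear dcomul_fun.
Proof.
move=> k p q; rewrite scaler_sumr -big_split; apply: eq_bigr => i _.
rewrite scaler_sumr -big_split; apply: eq_bigr => j _ /=.
have -> : ⟨k *: p + q|e i * e j⟩ = k * ⟨p|e i * e j⟩ + ⟨q|e i * e j⟩.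
  exact: (dpair_linl _ k p q).
by rewrite scalerDl scalerA.
Qed.
HB.instance Definition _ := GRing.isLinear.Build K (dual A)
  (tens (dual A) (dual A)) *:%R dcomul_fun dcomul_linear.

Definition dcounit_fun psi : K^o := ⟨psi|1⟩.
HB.instance Definition _ := GRing.isLinear.Build K (dual A) K^o *:%R
  dcounit_fun (dpair_linl 1).

Definition dantipode_fun psi : dual A := (psi \o antipode)%VF.
Lemma dantipode_linear : linear dantipode_fun.
Proof.
by move=> k p q; rewrite /dantipode_fun comp_lfunDl comp_lfunZl.
Qed.
HB.instance Definition _ := GRing.isLinear.Build K (dual A) (dual A) *:%R
  dantipode_fun dantipode_linear.

Definition dstar_fun psi x : K^o := ⟨psi|star (antipode x)⟩^*.
Lemma dstar_fun_linear psi : linear (dstar_fun psi).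
Proof.
move=> k x y; rewrite /dstar_fun linearP star_antilinear.
have -> u v : ⟨psi|k^* *: u + v⟩ = k^* * ⟨psi|u⟩ + ⟨psi|v⟩.
  exact: (dpair_linr psi).
by rewrite rmorphD rmorphM; congr (_ * _ + _); exact: conjCK.
Qed.
HB.instance Definition _ psi := GRing.isLinear.Build K A K^o *:%R
  (dstar_fun psi) (dstar_fun_linear psi).

Definition dcomul : 'Hom(dual A, tens (dual A) (dual A)) := linfun dcomul_fun.
Definition dcounit : 'Hom(dual A, K^o) := linfun dcounit_fun.
Definition dantipode : 'End(dual A) := linfun dantipode_fun.
Definition dstar psi : dual A := linfun (dstar_fun psi).

Lemma dstar_linear k phi psi :
  dstar (k *: phi + psi) = k^* *: dstar phi + dstar psi.
Proof.
apply: dualP => x.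
have -> : ⟨k^* *: dstar phi + dstar psi|x⟩ =
  k^* * ⟨dstar phi|x⟩ + ⟨dstar psi|x⟩ := dpair_linl x _ _ _.
rewrite /dpair !lfunE /= /dstar_fun.
set y := star _; have -> : ⟨k *: phi + psi|y⟩ = k * ⟨phi|y⟩ + ⟨psi|y⟩.
  exact: (dpair_linl y).
by rewrite rmorphD rmorphM.
Qed.

Let tlift_dcomul (W : lmodType K) (f : dual A -> dual A -> W) psi :
  bilin f -> tlift f (dcomul psi) =
  \sum_(i < \dim {:A}) \sum_(j < \dim {:A})
    ⟨psi|e i * e j⟩ *: f (dcoord i) (dcoord j).
Proof.
move=> bf; rewrite lfunE /= (linear_sum1 _ _ (tlift_linear f)).
apply: eq_bigr => i _; rewrite (linear_sumZ _ _ _ (tlift_linear f)).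
by apply: eq_bigr => j _; rewrite tlift_pure.
Qed.

Let basis_sum psi x y :
  \sum_(i < \dim {:A}) \sum_(j < \dim {:A})
    ⟨psi|e i * e j⟩ * (⟨dcoord i|x⟩ * ⟨dcoord j|y⟩) = ⟨psi|x * y⟩.
Proof.
have dl := dpair_linr psi.
rewrite [in RHS](coord_vbasis (memvf x)) mulr_suml.
under [in RHS]eq_bigr do rewrite -scalerAl.
rewrite (linear_sumZ _ _ _ dl); apply: eq_bigr => i _.
rewrite [in RHS](coord_vbasis (memvf y)) mulr_sumr.
under [in RHS]eq_bigr do rewrite -scalerAr.
rewrite (linear_sumZ _ _ _ dl) scaler_sumr; apply: eq_bigr => j _.
by rewrite !dcoordE scalerA mulrC.
Qed.

Let dpair_sum x (I : Type) (r : seq I) (c : I -> K) (F : I -> dual A) :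
  ⟨\sum_(i <- r) c i *: F i|x⟩ = \sum_(i <- r) c i * ⟨F i|x⟩.
Proof. exact: (linear_sumZ r c F (dpair_linl x)). Qed.

Let dpair_sum1 x (I : Type) (r : seq I) (F : I -> dual A) :
  ⟨\sum_(i <- r) F i|x⟩ = \sum_(i <- r) ⟨F i|x⟩.
Proof. exact: (linear_sum1 r F (dpair_linl x)). Qed.

Let dpairZ k psi x : ⟨k *: psi|x⟩ = k * ⟨psi|x⟩.
Proof. exact: (linear_scale _ _ (dpair_linl x)). Qed.

Lemma dcomulE psi x y :
  tlift (W := K^o) (fun phi chi => ⟨phi|x⟩ * ⟨chi|y⟩) (dcomul psi) =
  ⟨psi|x * y⟩.
Proof.
rewrite tlift_dcomul ?basis_sum //; split=> c k u v /=.
  have -> : ⟨k *: u + v|x⟩ = k * ⟨u|x⟩ + ⟨v|x⟩ := dpair_linl x k u v.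
  by rewrite mulrDl -mulrA.
have -> : ⟨k *: u + v|y⟩ = k * ⟨u|y⟩ + ⟨v|y⟩ := dpair_linl y k u v.
by rewrite mulrDr mulrCA.
Qed.

Let rcontr_dcomul psi x y : ⟨rcontr y (dcomul psi)|x⟩ = ⟨psi|x * y⟩.
Proof.
rewrite /rcontr tlift_dcomul; last exact: rcontr_bilin.
rewrite dpair_sum1 -basis_sum; apply: eq_bigr => i _.
rewrite dpair_sum; apply: eq_bigr => j _.
by rewrite dpairZ [⟨dcoord j|y⟩ * _]mulrC.
Qed.

Let dcomul_coassoc psi :
  tmap dcomul \1 (dcomul psi) = tassoc _ _ _ (tmap \1 dcomul (dcomul psi)).
Proof.
apply: rcontr_inj => z; apply: rcontr_inj => y; apply: dualP => x.
transitivity ⟨psi|x * y * z⟩.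
  rewrite {2}/rcontr tlift_tmap; last exact: rcontr_bilin.
  transitivity ⟨rcontr y (dcomul (rcontr z (dcomul psi)))|x⟩.
    congr (⟨rcontr y _|x⟩); rewrite [in RHS]/rcontr.
    rewrite (lin_tlift (F := dcomul)) => [|k u v]; last by rewrite linearP.
    by apply: eq_tlift => u v; rewrite id_lfunE linearZ.
  by rewrite !rcontr_dcomul.
rewrite -mulrA -(rcontr_dcomul psi x (y * z)).
congr (⟨_|x⟩); apply: esym; rewrite {2}/rcontr tlift_tassoc; last exact: rcontr_bilin.
rewrite tlift_tmap; last first.
  split=> c k u v /=; last exact: tlift_linear.
  apply: tlift_linear_fun => p q; rewrite (tpure_bilin _ _).1.
  by rewrite scalerDr !scalerA mulrC.
rewrite {1}/rcontr (lin_tlift _ _ (tlift_linear _)); apply: eq_tlift => p q.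
rewrite id_lfunE -dcomulE (lin_tlift _ _ (tlift_linear _)).
have lF : linear (fun k : K^o => (k : K) *: p).
  by move=> k u v; rewrite scalerDl scalerA.
rewrite (lin_tlift (F := fun k : K^o => (k : K) *: p) _ _ lF).
apply: eq_tlift => u v; rewrite (linear_scale _ _ (tlift_linear _)).
by rewrite tlift_pure ?scalerA 1?mulrC //; exact: rcontr_bilin.
Qed.

Let dcounitl psi :
  tlift (fun phi chi => (dcounit phi : K) *: chi) (dcomul psi) = psi.
Proof.
apply: dualP => y; rewrite tlift_dcomul; last first.
  split=> c k u v /=; last by rewrite scalerDr !scalerA mulrC.
  by rewrite linearP scalerDl scalerA.
rewrite -[in RHS](mul1r y) -basis_sum dpair_sum1; apply: eq_bigr => i _.
rewrite dpair_sum; apply: eq_bigr => j _.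
by rewrite dpairZ lfunE.
Qed.

Let dcounitr psi :
  tlift (fun phi chi => (dcounit chi : K) *: phi) (dcomul psi) = psi.
Proof.
apply: dualP => y; rewrite tlift_dcomul; last first.
  split=> c k u v /=; first by rewrite scalerDr !scalerA mulrC.
  by rewrite linearP scalerDl scalerA.
rewrite -[in RHS](mulr1 y) -basis_sum dpair_sum1; apply: eq_bigr => i _.
rewrite dpair_sum; apply: eq_bigr => j _.
by rewrite dpairZ lfunE [⟨dcoord i|_⟩ * _]mulrC.
Qed.

HB.instance Definition _ := isPreHopf.Build K (dual A)
  dantipode dcomul_coassoc dcounitl dcounitr dstar_linear.

Lemma dual_comulE psi x y :
  tlift (W := K^o) (fun phi chi => ⟨phi|x⟩ * ⟨chi|y⟩) (comul psi) =
  ⟨psi|x * y⟩.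
Proof. exact: dcomulE. Qed.

Lemma dual_counitE psi : counit psi = ⟨psi|1⟩.
Proof. exact: lfunE. Qed.

Lemma dual_antipodeE psi x : ⟨antipode psi|x⟩ = ⟨psi|antipode x⟩.
Proof. by rewrite [antipode psi]lfunE /= /dpair comp_lfunE. Qed.

Lemma dual_starE psi x : ⟨star psi|x⟩ = ⟨psi|star (antipode x)⟩^*.
Proof. exact: (lfunE (dstar_fun psi) x). Qed.

End DualCoalgebra.

(* Completeness is automatic in finite dimension. *)
Definition cstar_norm (K : numClosedFieldType) (A : falgType K) (st : A -> A)
    (N : A -> K) : Prop :=
  [/\ forall x, 0 <= N x, forall x, N x = 0 -> x = 0,
      forall x y, N (x + y) <= N x + N y,
      forall (c : K) x, N (c *: x) = `|c| * N x &
      (forall x y, N (x * y) <= N x * N y) /\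
      (forall x, N (st x * x) = N x ^+ 2)].

(* comul_coassoc, counitl, counitr and star_antilinear of PreHopf are part of
   the definition. *)
HB.mixin Record isWeakCstarHopf (K : numClosedFieldType) A of PreHopf K A := {
  starK : forall x : A, star (star x) = x;
  starM : forall x y : A, star (x * y) = star y * star x;
  cstar_normed : exists N : A -> K, cstar_norm star N;
  comulM : forall x y : A, comul (x * y) = comul x * comul y;
  comul_star : forall x : A, comul (star x) = tstar (comul x);
  comul_weak1 : (comul 1 ⊗ 1) * tassoc A A A (1 ⊗ comul 1) =
    tmap comul \1 (comul 1);
  counit_weakM : forall x y z : A, counit (x * y * z) =
    tlift (W := K^o) (fun y1 y2 => counit (x * y1) * counit (y2 * z)) (comul y);
  antipodel : forall x : A,
    tlift (fun x1 x2 => antipode x1 * x2) (comul x) =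
    tlift (fun e1 e2 => (counit (x * e2) : K) *: e1) (comul 1);
  antipoder : forall x : A,
    tlift (fun x1 x2 => x1 * antipode x2) (comul x) =
    tlift (fun e1 e2 => (counit (e1 * x) : K) *: e2) (comul 1);
  antipode_mid : forall x : A,
    tlift (fun x12 x3 =>
        tlift (fun x1 x2 => antipode x1 * x2 * antipode x3) (comul x12))
      (comul x) = antipode x
}.

#[short(type="weakCstarHopfType")]
HB.structure Definition WeakCstarHopf (K : numClosedFieldType) :=
  { A of PreHopf K A & isWeakCstarHopf K A }.

Section Actions.
Variables (K : numClosedFieldType) (A : preHopfType K).

(* a ⇀ phi *)
Definition actl (a : A) (phi : dual A) : dual A := (phi \o amulr a)%VF.
(* phi ↼ a *)
Definition actr (phi : dual A) (a : A) : dual A := (phi \o amull a)%VF.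
(* phi ⇀ a *)
Definition coactl (phi : dual A) (a : A) : A :=
  tlift (fun a1 a2 => ⟨phi|a2⟩ *: a1) (comul a).
(* a ↼ phi *)
Definition coactr (a : A) (phi : dual A) : A :=
  tlift (fun a1 a2 => ⟨phi|a1⟩ *: a2) (comul a).

Lemma actlE a phi b : ⟨actl a phi|b⟩ = ⟨phi|b * a⟩.
Proof. by rewrite /dpair comp_lfunE lfunE. Qed.

Lemma actrE phi a b : ⟨actr phi a|b⟩ = ⟨phi|a * b⟩.
Proof. by rewrite /dpair comp_lfunE lfunE. Qed.

Definition epsR (a : A) : dual A := actl a 1.
Definition epsL (a : A) : dual A := actr 1 a.
Definition hepsR (phi : dual A) : A := coactl phi 1.
Definition hepsL (phi : dual A) : A := coactr 1 phi.

Lemma epsR_linear : linear epsR.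
Proof. by move=> k a b; rewrite /epsR /actl linearP comp_lfunDr comp_lfunZr. Qed.
Lemma epsL_linear : linear epsL.
Proof. by move=> k a b; rewrite /epsL /actr linearP comp_lfunDr comp_lfunZr. Qed.

Lemma hepsR_linear : linear hepsR.
Proof.
move=> k p q; apply: tlift_linear_fun => u v.
have -> : ⟨k *: p + q|v⟩ = k * ⟨p|v⟩ + ⟨q|v⟩ := dpair_linl v k p q.
by rewrite scalerDl scalerA.
Qed.
Lemma hepsL_linear : linear hepsL.
Proof.
move=> k p q; apply: tlift_linear_fun => u v.
have -> : ⟨k *: p + q|u⟩ = k * ⟨p|u⟩ + ⟨q|u⟩ := dpair_linl u k p q.
by rewrite scalerDl scalerA.
Qed.

HB.instance Definition _ := GRing.isLinear.Build K A (dual A) *:%R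
  epsR epsR_linear.
HB.instance Definition _ := GRing.isLinear.Build K A (dual A) *:%R
  epsL epsL_linear.
HB.instance Definition _ := GRing.isLinear.Build K (dual A) A *:%R
  hepsR hepsR_linear.
HB.instance Definition _ := GRing.isLinear.Build K (dual A) A *:%R
  hepsL hepsL_linear.

(* Â_R, Â_L, A_R, A_L; hepsR, hepsL are the maps ε̂_R, ε̂_L *)
Definition hatA_R : {vspace dual A} := limg (linfun epsR).
Definition hatA_L : {vspace dual A} := limg (linfun epsL).
Definition A_R : {vspace A} := limg (linfun hepsR).
Definition A_L : {vspace A} := limg (linfun hepsL).

Definition nondegenerate_form (V : vectType K) (f : V -> V -> K) : Prop :=
  (forall u, (forall v, f u v = 0) -> u = 0) /\
  (forall v, (forall u, f u v = 0) -> v = 0).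

Definition nondegenerate_int (l : A) : Prop :=
  nondegenerate_form (fun phi psi : dual A => ⟨phi * psi|l⟩).
Definition hat_nondegenerate_int (lam : dual A) : Prop :=
  nondegenerate_form (fun a b : A => ⟨lam|a * b⟩).

Definition normalized_int (l : A) : Prop := actl l 1 = 1.
Definition hat_normalized_int (lam : dual A) : Prop := coactl lam 1 = 1.

Definition dual_pair (l : A) (lam : dual A) : Prop := coactl lam l = 1.

End Actions.

Arguments hatA_R {K} A.
Arguments hatA_L {K} A.
Arguments A_R {K} A.
Arguments A_L {K} A.

(* The following apply both to A and to Â. *)
Section Integrals.
Variables (K : numClosedFieldType) (H : preHopfType K).

Definition left_integral (l : H) : Prop := forall a : H,
  a * l = tlift (fun a1 a2 => a1 * antipode a2) (comul a) * l.

Definition nR (l : H) : H :=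
  tlift (fun l1 l2 => l2 * antipode_inv H l1) (comul l).

(* l_(2) ⊗ S^-1(l_(1)) *)
Definition qb_tensor (l : H) : tens H H :=
  tlift (fun l1 l2 => l2 ⊗ antipode_inv H l1) (comul l).

End Integrals.

Section Index.
Variables (K : fieldType) (B : falgType K).

Definition quasi_basis (E : B -> B) (n : nat) (u v : 'I_n -> B) : Prop :=
  forall b, \sum_i u i * E (v i * b) = b /\ \sum_i E (b * u i) * v i = b.

Definition index_finite_type (D : {vspace B}) (E : B -> B) : Prop :=
  (forall b, E b \in D) /\
  exists (n : nat) (u v : 'I_n -> B), quasi_basis E u v.

Definition tensor_quasi_basis (E : B -> B) (t : tens B B) : Prop :=
  forall (n : nat) (u v : 'I_n -> B),
    \sum_i u i ⊗ v i = t -> quasi_basis E u v.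

Definition is_index (E : B -> B) (c : B) : Prop :=
  exists (n : nat) (u v : 'I_n -> B),
    quasi_basis E u v /\ c = \sum_i u i * v i.

(* does not depend on the quasi-basis; 0 if there is none *)
Definition watatani_index (E : B -> B) : B := xget 0 (is_index E).

Lemma is_index_uniq (E : B -> B) c d :
  is_index E c -> is_index E d -> c = d.
Proof.
move=> [n [u [v [uv ->]]]] [m [u' [v' [uv' ->]]]].
transitivity (\sum_i \sum_j u' j * E (v' j * u i) * v i).
  by apply: eq_bigr => i _; rewrite -{1}(uv' (u i)).1 mulr_suml.
rewrite exchange_big; apply: eq_bigr => j _ /=.
by under eq_bigr do rewrite -mulrA; rewrite -mulr_sumr (uv (v' j)).2.
Qed.

End Index.

Section ConditionalExpectations.
Variables (K : numClosedFieldType) (A : preHopfType K).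

Definition E_ (l : A) : dual A -> dual A := fun phi => actl l phi.
Definition hatE_ (lam : dual A) : A -> A := fun a => coactl lam a.

Definition Ind (l : A) : dual A := watatani_index (E_ l).
Definition hatInd (lam : dual A) : A := watatani_index (hatE_ lam).

End ConditionalExpectations.

(* Main.v *)
From HB Require Import structures.
Require Import Defs.
From mathcomp Require Import all_boot all_order all_algebra all_field.
From mathcomp Require Import boolp classical_sets.
From mathcomp Require Import reals complex.
Import GRing.Theory Num.Theory.
Local Open Scope ring_scope.

(* Parts (i) and (ii) are the same statement for the dual pairs (A, l, λ) and
   (Â, λ, ev l). For a left integral l one has l_(1) ⊗ x l_(2) = S(x) l_(1) ⊗ l_(2),
   so E_λ(x l_(2)) S^-1(l_(1)) = E_λ(l_(2)) S^-1(l_(1)) x = x because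
   λ ⇀ l = 1 and 1_(2) S^-1(1_(1)) = 1. The other quasi-basis identity follows
   from this one, E_λ being an A_L-bimodule map with nondegenerate λ. The index
   is n_R(l) = S^-1(ε_t(l)), where ε_t(x) = x_(1) S(x_(2)), and
   S^-1(A_L) = A_R; the index of any map is central.
   For (iv), c = Ind l corresponds to the central element z = ε̂_L(c) of
   A_L ∩ A_R, and c ⇀ x = z x; from λ = c λ̇ one gets E_λ = z E_λ̇, so
   multiplying a quasi-basis of E_λ by z gives Ind λ̇ = z n_R(l) = z.
   Normalization of λ̇ comes from c = S(c) = ε_t(λ) = c ε_t(λ̇). *)

Set Implicit Arguments.
Unset Strict Implicit.
Unset Printing Implicit Defensive.

(* Sweedler sum: for t = comul x, the letters a, b stand for x_(1), x_(2). *)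
Notation "\sw_ ( a , b <- t ) F" := (tlift (fun a b => F) t)
  (at level 41, F at level 41, a name, b name, t at level 50,
   format "'[' \sw_ ( a ,  b  <-  t ) '/  '  F ']'") : ring_scope.

(** Passing from A to its dual has to preserve whatever the argument uses, so everything up to the
    quasi-basis is proved for an [H] satisfying [weak_hopf] and having a surjective antipode. On A
    both properties come out of the star: it reverses products but keeps the legs of Δ in order,
    which yields the primed axioms, and x ↦ [star (S (star x))] is a right inverse of S. On the dual
    both are obtained by transposition: products become coproducts, the counit axioms and the
    weak-unit axioms change places, and S becomes its transpose. In the quasi-basis argument l is
    used as a left integral, whereas λ enters through three consequences: E has values in A_L, λ is
    nondegenerate, and E(l) = 1. For the pair on the dual side, where the functional is [ev l],
    these three facts are computed in A. *)

(** * Linearity of expressions built from Sweedler sums *)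

Section Linearity.
Variable K : fieldType.

Lemma lin_id (U : lmodType K) : linear (fun x : U => x).
Proof. by []. Qed.

Lemma lin_hom (U : lmodType K) (V W : vectType K) (g : 'Hom(V, W)) (f : U -> V) :
  linear f -> linear (fun x => g (f x)).
Proof. by move=> lf a x y; rewrite lf linearP. Qed.

Lemma lin_mull (U : lmodType K) (B : falgType K) (b : B) (f : U -> B) :
  linear f -> linear (fun x => f x * b).
Proof. by move=> lf a x y; rewrite lf mulrDl -scalerAl. Qed.

Lemma lin_mulr (U : lmodType K) (B : falgType K) (b : B) (f : U -> B) :
  linear f -> linear (fun x => b * f x).
Proof. by move=> lf a x y; rewrite lf mulrDr -scalerAr. Qed.

Lemma lin_purel (U : lmodType K) (V W : vectType K) (w : W) (f : U -> V) :
  linear f -> linear (fun x => f x ⊗ w).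
Proof. by move=> lf a x y; rewrite lf (tpure_bilin _ _).1. Qed.

Lemma lin_purer (U : lmodType K) (V W : vectType K) (v : V) (f : U -> W) :
  linear f -> linear (fun x => v ⊗ f x).
Proof. by move=> lf a x y; rewrite lf (tpure_bilin _ _).2. Qed.

Lemma lin_scalel (U W : lmodType K) (w : W) (f : U -> K^o) :
  linear f -> linear (fun x => (f x : K) *: w).
Proof. by move=> lf a x y; rewrite lf scalerDl scalerA. Qed.

Lemma lin_scaler (U W : lmodType K) (c : K) (f : U -> W) :
  linear f -> linear (fun x => c *: f x).
Proof. by move=> lf a x y; rewrite lf scalerDr !scalerA mulrC. Qed.

Lemma lin_dpairl (U : lmodType K) (V : vectType K) (v : V) (f : U -> dual V) :
  linear f -> linear (fun x => ⟨f x|v⟩ : K^o).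
Proof. by move=> lf a x y; rewrite lf; exact: dpair_linl. Qed.

Lemma lin_dpairr (U : lmodType K) (V : vectType K) (phi : dual V) (f : U -> V) :
  linear f -> linear (fun x => ⟨phi|f x⟩ : K^o).
Proof. by move=> lf a x y; rewrite lf; exact: dpair_linr. Qed.

Lemma lin_tlift_tens (T : lmodType K) (U V : vectType K) (W : lmodType K)
    (f : U -> V -> W) (t : T -> tens U V) :
  linear t -> linear (fun x => tlift f (t x)).
Proof. by move=> lt a x y; rewrite lt tlift_linear. Qed.

Lemma lin_tlift_fun (T : lmodType K) (U V : vectType K) (W : lmodType K)
    (f : T -> U -> V -> W) (t : tens U V) :
  (forall u v, linear (fun x => f x u v)) -> linear (fun x => tlift (f x) t).
Proof. by move=> lf a x y; apply: tlift_linear_fun => u v; exact: lf. Qed.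

Lemma tlift_exchange (U V U' V' : vectType K) (W : lmodType K)
    (f : U -> V -> U' -> V' -> W) s t :
  \sw_(a, b <- s) \sw_(c, d <- t) f a b c d =
  \sw_(c, d <- t) \sw_(a, b <- s) f a b c d.
Proof.
rewrite [LHS]/tlift.
transitivity (\sum_i \sum_j \sw_(c, d <- t)
    (tcoef s i j *: f (vbasis {:U})`_i (vbasis {:V})`_j c d)).
  apply: eq_bigr => i _; apply: eq_bigr => j _.
  by apply: lin_tlift; apply/lin_scaler/lin_id.
rewrite /tlift; under eq_bigr do rewrite exchange_big.
rewrite exchange_big; apply: eq_bigr => k _ /=.
under eq_bigr do rewrite exchange_big.
rewrite exchange_big; apply: eq_bigr => m _ /=.
by rewrite scaler_sumr; apply: eq_bigr => i _; rewrite scaler_sumr.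
Qed.

End Linearity.

Section BilinearApplication.
Variables (K : fieldType) (T : lmodType K) (U V : vectType K) (W : lmodType K).
Variables (g : U -> V -> W).
Hypothesis bg : bilin g.

Lemma lin_bill (f : T -> U) v : linear f -> linear (fun x => g (f x) v).
Proof. by move=> lf a x y; rewrite lf; exact: bg.1. Qed.

Lemma lin_bilr (f : T -> V) u : linear f -> linear (fun x => g u (f x)).
Proof. by move=> lf a x y; rewrite lf; exact: bg.2. Qed.

End BilinearApplication.

(** Descends along the syntax of the map. The [linear _] fallback serves eta-contracted maps and
    draws on the linearity and [bilin] hypotheses of the context. *)
Ltac linearity := lazymatch goal with
  | |- bilin _ => split; intro; linearity
  | |- linear (fun x => x) => apply: lin_id
  | |- linear (fun x => GRing.mul _ _) =>
      first [ apply: lin_mull; linearity | apply: lin_mulr; linearity ]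
  | |- linear (fun x => fun_of_lfun _ _) => apply: lin_hom; linearity
  | |- linear (fun x => tpure _ _) =>
      first [ apply: lin_purel; linearity | apply: lin_purer; linearity ]
  | |- linear (fun x => GRing.scale _ _) =>
      first [ apply: lin_scalel; linearity | apply: lin_scaler; linearity ]
  | |- linear (fun x => dpair _ _) =>
      first [ apply: lin_dpairl; linearity | apply: lin_dpairr; linearity ]
  | |- linear (fun x => tlift _ _) =>
      first [ apply: lin_tlift_tens; linearity
            | apply: lin_tlift_fun => ? ?; linearity ]
  | |- linear _ => first
    [ by eauto
    | match goal with bg : bilin _ |- _ => apply: (lin_bill bg); linearity end
    | match goal with bg : bilin _ |- _ => apply: (lin_bilr bg); linearity end
    | apply: lin_hom; linearity
    | apply: lin_mulr; linearity | apply: lin_purer; linearity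
    | apply: lin_id
    | apply: lin_tlift_tens; linearity
    | apply: lin_scaler; linearity ]
  | |- forall _, _ => intro; linearity
  end.

(** * Coassociativity and slices of tensors *)

Section Coalgebra.
Variables (K : numClosedFieldType) (H : preHopfType K).

Lemma sw_coassoc (W : lmodType K) (f : H -> H -> H -> W) (x : H) :
  (forall b c, linear (fun a => f a b c)) ->
  (forall a c, linear (fun b => f a b c)) ->
  (forall a b, linear (f a b)) ->
  \sw_(a, b <- comul x) \sw_(c, d <- comul a) f c d b =
  \sw_(a, b <- comul x) \sw_(c, d <- comul b) f a c d.
Proof.
move=> f1 f2 f3; pose g (t : tens H H) c := \sw_(a, b <- t) f a b c.
have bg : bilin g.
  by split=> [c|t]; rewrite /g; linearity.
transitivity (tlift g (tmap comul \1 (comul x))).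
  by rewrite tlift_tmap //; apply: eq_tlift => a b; rewrite id_lfunE.
rewrite comul_coassoc tlift_tassoc // tlift_tmap; last first.
  split=> [b|a]; rewrite ?/g; linearity.
apply: eq_tlift => a b; rewrite id_lfunE; apply: eq_tlift => c d.
by rewrite /g tlift_pure //; split.
Qed.

End Coalgebra.

Section TensCoordinates.
Variables (K : fieldType) (U V : vectType K).
Implicit Types t : tens U V.
Local Notation e i := (vbasis {:U})`_i.
Local Notation f j := (vbasis {:V})`_j.

Lemma tens_coordl t :
  t = \sum_(i < \dim {:U}) e i ⊗ (\sw_(a, b <- t) ⟨dcoord i|a⟩ *: b).
Proof.
move: t; apply: tens_ext => // [c s t|u v].
  rewrite scaler_sumr -big_split; apply: eq_bigr => i _ /=.
  by rewrite tlift_linear (tpure_bilin _ _).2.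
rewrite {1}(coord_vbasis (memvf u)) (linear_sumZ _ _ _ ((tpure_bilin U V).1 v)).
apply: eq_bigr => i _; rewrite tlift_pure; last by linearity.
by rewrite (linear_scale _ _ ((tpure_bilin U V).2 _)) dcoordE.
Qed.

Lemma tens_coordr t :
  t = \sum_(j < \dim {:V}) (\sw_(a, b <- t) ⟨dcoord j|b⟩ *: a) ⊗ f j.
Proof.
move: t; apply: tens_ext => // [c s t|u v].
  rewrite scaler_sumr -big_split; apply: eq_bigr => i _ /=.
  by rewrite tlift_linear (tpure_bilin _ _).1.
rewrite {1}(coord_vbasis (memvf v)) (linear_sumZ _ _ _ ((tpure_bilin U V).2 u)).
apply: eq_bigr => i _; rewrite tlift_pure; last by linearity.
by rewrite (linear_scale _ _ ((tpure_bilin U V).1 _)) dcoordE.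
Qed.

Lemma tlift_sum (W : lmodType K) (g : U -> V -> W) (n : nat) (u : 'I_n -> U)
    (v : 'I_n -> V) :
  bilin g -> tlift g (\sum_i u i ⊗ v i) = \sum_i g (u i) (v i).
Proof.
move=> bg; rewrite (linear_sum1 _ _ (tlift_linear g)).
by apply: eq_bigr => i _; rewrite tlift_pure.
Qed.

(** [tlift] sums over fixed basis vectors, which may fail P; expanding [t] over a basis of the other
    factor puts slices of [t] in their place. *)
Lemma eq_tlift_legl (W : lmodType K) (g h : U -> V -> W) t (P : U -> Prop) :
  bilin g -> bilin h -> (forall phi, P (\sw_(a, b <- t) ⟨phi|b⟩ *: a)) ->
  (forall a b, P a -> g a b = h a b) -> tlift g t = tlift h t.
Proof.
move=> bg bh Pt gh; rewrite (tens_coordr t) !tlift_sum //.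
by apply: eq_bigr => i _; apply: gh.
Qed.

Lemma eq_tlift_legr (W : lmodType K) (g h : U -> V -> W) t (P : V -> Prop) :
  bilin g -> bilin h -> (forall phi, P (\sw_(a, b <- t) ⟨phi|a⟩ *: b)) ->
  (forall a b, P b -> g a b = h a b) -> tlift g t = tlift h t.
Proof.
move=> bg bh Pt gh; rewrite (tens_coordl t) !tlift_sum //.
by apply: eq_bigr => i _; apply: gh.
Qed.

End TensCoordinates.

Lemma sw_mul (K : fieldType) (B C : falgType K) (W : lmodType K)
    (g : B -> C -> W) (s t : tens B C) :
  bilin g -> tlift g (s * t) = \sw_(a, b <- s) \sw_(c, d <- t) g (a * c) (b * d).
Proof.
move=> bg; rewrite (lin_tlift _ _ (tlift_linear g)); apply: eq_tlift => a b.
rewrite (lin_tlift _ _ (tlift_linear g)); apply: eq_tlift => c d.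
exact: tlift_pure.
Qed.

(* Unlike isWeakCstarHopf this is visibly self-dual: the primed axioms, which
   the star yields on A, carry over to the dual without a star there. *)
Record weak_hopf (K : numClosedFieldType) (H : preHopfType K) : Prop := {
  wh_comulM : forall x y : H, comul (x * y) = comul x * comul y;
  wh_comul1 :
    \sw_(a, b <- comul (1 : H)) \sw_(c, d <- comul (1 : H)) (a ⊗ (b * c) ⊗ d) =
    \sw_(a, b <- comul 1) \sw_(c, d <- comul b) (a ⊗ c ⊗ d);
  wh_comul1' :
    \sw_(a, b <- comul (1 : H)) \sw_(c, d <- comul (1 : H)) (a ⊗ (c * b) ⊗ d) =
    \sw_(a, b <- comul 1) \sw_(c, d <- comul b) (a ⊗ c ⊗ d);
  wh_counit : forall x y z : H, counit (x * y * z) =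
    \sw_(a, b <- comul y) (counit (x * a) : K) *: counit (b * z);
  wh_counit' : forall x y z : H, counit (x * y * z) =
    \sw_(a, b <- comul y) (counit (x * b) : K) *: counit (a * z);
  wh_antipodel : forall x : H, \sw_(a, b <- comul x) antipode a * b =
    \sw_(a, b <- comul 1) (counit (x * b) : K) *: a;
  wh_antipoder : forall x : H, \sw_(a, b <- comul x) a * antipode b =
    \sw_(a, b <- comul 1) (counit (a * x) : K) *: b;
  wh_antipode_mid : forall x : H,
    \sw_(a, b <- comul x) \sw_(c, d <- comul a) antipode c * d * antipode b =
    antipode x
}.

(** * The base algebras A_L, A_R and the legs of Δ(1) *)

Section BaseAlgebras.
Variables (K : numClosedFieldType) (H : preHopfType K) (wH : weak_hopf H).
Implicit Types (x y z w : H) (phi : dual H).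
Local Notation S := (antipode : 'End(H)).

Lemma A_LP z : reflect (exists phi, z = hepsL phi) (z \in A_L H).
Proof.
apply: (iffP memv_imgP) => [[phi _ ->]|[phi ->]]; exists phi;
  by rewrite ?lfunE ?memvf.
Qed.

Lemma A_RP w : reflect (exists phi, w = hepsR phi) (w \in A_R H).
Proof.
apply: (iffP memv_imgP) => [[phi _ ->]|[phi ->]]; exists phi;
  by rewrite ?lfunE ?memvf.
Qed.

(** The slices (φ ⊗ id)Δ(1) are exactly the elements of A_L, so the second leg of Δ(1) may be taken
    there; likewise the first leg in A_R. *)
Lemma eq_sw1_A_L (W : lmodType K) (g h : H -> H -> W) :
  bilin g -> bilin h -> (forall a b, b \in A_L H -> g a b = h a b) ->
  tlift g (comul 1) = tlift h (comul 1).
Proof.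
move=> bg bh; apply: (eq_tlift_legr (P := fun b => b \in A_L H)) => // phi.
by apply/A_LP; exists phi.
Qed.

Lemma eq_sw1_A_R (W : lmodType K) (g h : H -> H -> W) :
  bilin g -> bilin h -> (forall a b, a \in A_R H -> g a b = h a b) ->
  tlift g (comul 1) = tlift h (comul 1).
Proof.
move=> bg bh; apply: (eq_tlift_legl (P := fun b => b \in A_R H)) => // phi.
by apply/A_RP; exists phi.
Qed.

Section Trilinear.
Variables (W : lmodType K) (f : H -> H -> H -> W).
Hypotheses (f1 : forall b c, linear (fun a => f a b c))
  (f2 : forall a c, linear (fun b => f a b c)) (f3 : forall a b, linear (f a b)).

Let tri (t : tens (tens H H) H) : W := \sw_(s, c <- t) \sw_(a, b <- s) f a b c.
Let tri_pure a b c : tri (a ⊗ b ⊗ c) = f a b c.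
Proof.
rewrite /tri tlift_pure; last by linearity.
by rewrite tlift_pure //; split.
Qed.
Let tri_linear : linear tri. Proof. exact: tlift_linear. Qed.

(** The universal property of the triple tensor product makes the axiom usable inside any trilinear
    expression. [op] is the product or its opposite, so one proof serves both weak-unit axioms. *)
Lemma sw_trilinear (op : H -> H -> H) :
  \sw_(a, b <- comul (1 : H)) \sw_(c, d <- comul (1 : H)) (a ⊗ op b c ⊗ d) =
  \sw_(a, b <- comul (1 : H)) \sw_(c, d <- comul b) (a ⊗ c ⊗ d) ->
  \sw_(a, b <- comul (1 : H)) \sw_(c, d <- comul (1 : H)) f a (op b c) d =
  \sw_(a, b <- comul 1) \sw_(c, d <- comul b) f a c d.
Proof.
move/(congr1 tri); rewrite !(lin_tlift _ _ tri_linear) => E.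
by apply: etrans (etrans _ E) _; apply: eq_tlift => a b;
  rewrite (lin_tlift _ _ tri_linear); apply: eq_tlift => c d; rewrite tri_pure.
Qed.

Lemma sw_comul1 :
  \sw_(a, b <- comul (1 : H)) \sw_(c, d <- comul (1 : H)) f a (b * c) d =
  \sw_(a, b <- comul 1) \sw_(c, d <- comul b) f a c d.
Proof. exact: sw_trilinear (wh_comul1 wH). Qed.

Lemma sw_comul1' :
  \sw_(a, b <- comul (1 : H)) \sw_(c, d <- comul (1 : H)) f a (c * b) d =
  \sw_(a, b <- comul 1) \sw_(c, d <- comul b) f a c d.
Proof. exact: (sw_trilinear (op := fun b c => c * b)) (wh_comul1' wH). Qed.

End Trilinear.

End BaseAlgebras.

(** * Counital maps and coproducts involving the base algebras *)

Section ElementaryTheory.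
Variables (K : numClosedFieldType) (H : preHopfType K) (wH : weak_hopf H).
Implicit Types (x y z w : H) (phi : dual H).
Local Notation S := (antipode : 'End(H)).

(** The target counital map; [epss] is the source one, usually written ε_s. *)
Definition epst x : H := \sw_(a, b <- comul x) a * S b.
Definition epss x : H := \sw_(a, b <- comul x) S a * b.

Section Bilinear.
Variables (W : lmodType K) (f : H -> H -> W).
Hypothesis bf : bilin f.

Lemma sw_comulM x y : tlift f (comul (x * y)) =
  \sw_(a, b <- comul x) \sw_(c, d <- comul y) f (a * c) (b * d).
Proof. by rewrite (wh_comulM wH) sw_mul. Qed.

Lemma sw_hepsL phi : tlift f (comul (hepsL phi)) =
  \sw_(a, b <- comul (1 : H)) \sw_(c, d <- comul b) ⟨phi|a⟩ *: f c d.
Proof.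
rewrite /hepsL /coactr (lin_tlift (F := fun u => tlift f (comul u))); last by linearity.
apply: eq_tlift => a b; rewrite linearZ linearZ /=.
by apply: lin_tlift; linearity.
Qed.

Lemma sw_hepsR phi : tlift f (comul (hepsR phi)) =
  \sw_(a, b <- comul (1 : H)) \sw_(c, d <- comul b) ⟨phi|d⟩ *: f a c.
Proof.
rewrite /hepsR /coactl (lin_tlift (F := fun u => tlift f (comul u))); last by linearity.
rewrite -(sw_coassoc (f := fun c d b => ⟨phi|b⟩ *: f c d)); try by linearity.
apply: eq_tlift => a b; rewrite linearZ linearZ /=.
by apply: lin_tlift; linearity.
Qed.

(** Apply φ to the first factor of 1_(1) ⊗ 1_(2) 1'_(1) ⊗ 1'_(2): what remains is z 1'_(1) ⊗ 1'_(2),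
    while the other side of the weak-unit axiom becomes Δ(z). The next three lemmas are its mirror
    images. *)
Lemma sw1_A_Ll z : z \in A_L H ->
  tlift f (comul z) = \sw_(a, b <- comul 1) f (z * a) b.
Proof.
move/A_LP=> [phi ->]; rewrite sw_hepsL.
rewrite -(sw_comul1 wH (f := fun a c d => ⟨phi|a⟩ *: f c d)); try by linearity.
rewrite tlift_exchange; apply: eq_tlift => c d; rewrite /hepsL /coactr.
rewrite (lin_tlift (F := fun u => f (u * c) d)); last by linearity.
by apply: eq_tlift => a b; rewrite -scalerAl (linear_scale _ _ (bf.1 _)).
Qed.

Lemma sw1_A_Lr z : z \in A_L H ->
  tlift f (comul z) = \sw_(a, b <- comul 1) f (a * z) b.
Proof.
move/A_LP=> [phi ->]; rewrite sw_hepsL.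
rewrite -(sw_comul1' wH (f := fun a c d => ⟨phi|a⟩ *: f c d)); try by linearity.
rewrite tlift_exchange; apply: eq_tlift => c d; rewrite /hepsL /coactr.
rewrite (lin_tlift (F := fun u => f (c * u) d)); last by linearity.
by apply: eq_tlift => a b; rewrite -scalerAr (linear_scale _ _ (bf.1 _)).
Qed.

Lemma sw1_A_Rr w : w \in A_R H ->
  tlift f (comul w) = \sw_(a, b <- comul 1) f a (b * w).
Proof.
move/A_RP=> [phi ->]; rewrite sw_hepsR.
rewrite -(sw_comul1 wH (f := fun a c d => ⟨phi|d⟩ *: f a c)); try by linearity.
apply: eq_tlift => a b; rewrite /hepsR /coactl.
rewrite (lin_tlift (F := fun u => f a (b * u))); last by linearity.
by apply: eq_tlift => c d; rewrite -scalerAr (linear_scale _ _ (bf.2 _)).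
Qed.

Lemma sw1_A_Rl w : w \in A_R H ->
  tlift f (comul w) = \sw_(a, b <- comul 1) f a (w * b).
Proof.
move/A_RP=> [phi ->]; rewrite sw_hepsR.
rewrite -(sw_comul1' wH (f := fun a c d => ⟨phi|d⟩ *: f a c)); try by linearity.
apply: eq_tlift => a b; rewrite /hepsR /coactl.
rewrite (lin_tlift (F := fun u => f a (u * b))); last by linearity.
by apply: eq_tlift => c d; rewrite -scalerAl (linear_scale _ _ (bf.2 _)).
Qed.

End Bilinear.

Section BilinearModule.
Variables (W : lmodType K) (f : H -> H -> W).
Hypothesis bf : bilin f.

(** The factor Δ(1) left over from [sw1_A_Ll] is absorbed, since Δ(1)Δ(x) = Δ(x). *)
Lemma sw_A_Ll z x : z \in A_L H ->
  tlift f (comul (z * x)) = \sw_(a, b <- comul x) f (z * a) b.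
Proof.
move=> zA; rewrite sw_comulM // sw1_A_Ll //; last by linearity.
rewrite -[x in RHS]mul1r sw_comulM; last by linearity.
by do 2!apply: eq_tlift => ? ?; rewrite mulrA.
Qed.

Lemma sw_A_Lr z x : z \in A_L H ->
  tlift f (comul (x * z)) = \sw_(a, b <- comul x) f (a * z) b.
Proof.
move=> zA; rewrite sw_comulM // -[x in RHS]mulr1 sw_comulM; last by linearity.
apply: eq_tlift => a b; rewrite sw1_A_Lr //; last by linearity.
by apply: eq_tlift => c d; rewrite mulrA.
Qed.

Lemma sw_A_Rl w x : w \in A_R H ->
  tlift f (comul (w * x)) = \sw_(a, b <- comul x) f a (w * b).
Proof.
move=> zA; rewrite sw_comulM // sw1_A_Rl //; last by linearity.
rewrite -[x in RHS]mul1r sw_comulM; last by linearity.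
by do 2!apply: eq_tlift => ? ?; rewrite mulrA.
Qed.

Lemma sw_A_Rr w x : w \in A_R H ->
  tlift f (comul (x * w)) = \sw_(a, b <- comul x) f a (b * w).
Proof.
move=> zA; rewrite sw_comulM // -[x in RHS]mulr1 sw_comulM; last by linearity.
apply: eq_tlift => a b; rewrite sw1_A_Rr //; last by linearity.
by apply: eq_tlift => c d; rewrite mulrA.
Qed.

End BilinearModule.

(** Apply ε ⊗ id to Δ(x z) = Δ(x)(z ⊗ 1). This and its variants recover base algebra elements from
    values of the counit. *)
Lemma counit_A_Lr z x : z \in A_L H ->
  \sw_(a, b <- comul x) (counit (a * z) : K) *: b = x * z.
Proof.
move=> zA; rewrite -(sw_A_Lr (f := fun a b => (counit a : K) *: b)) ?counitl //.
by linearity.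
Qed.

Lemma counit_A_Ll z x : z \in A_L H ->
  \sw_(a, b <- comul x) (counit (z * a) : K) *: b = z * x.
Proof.
move=> zA; rewrite -(sw_A_Ll (f := fun a b => (counit a : K) *: b)) ?counitl //.
by linearity.
Qed.

Lemma counit_A_Rr w x : w \in A_R H ->
  \sw_(a, b <- comul x) (counit (b * w) : K) *: a = x * w.
Proof.
move=> zA; rewrite -(sw_A_Rr (f := fun a b => (counit b : K) *: a)) ?counitr //.
by linearity.
Qed.

(** Both products are outer slices of the single tensor 1_(1) ⊗ 1_(2) ⊗ 1_(3), which the two
    weak-unit axioms write with the middle factors in either order. *)
Lemma A_LR_comm z w : z \in A_L H -> w \in A_R H -> z * w = w * z.
Proof.
move=> /A_LP[phi ->] /A_RP[psi ->].
have E := sw_comul1 wH (f := fun a b c => ⟨phi|a⟩ *: (⟨psi|c⟩ *: b)).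
have E' := sw_comul1' wH (f := fun a b c => ⟨phi|a⟩ *: (⟨psi|c⟩ *: b)).
transitivity (\sw_(a, b <- comul (1 : H)) \sw_(c, d <- comul (1 : H))
  ⟨phi|a⟩ *: (⟨psi|d⟩ *: (b * c))).
  rewrite /hepsL /coactr (lin_tlift (F := fun u => u * _)); last by linearity.
  apply: eq_tlift => a b; rewrite /hepsR /coactl.
  rewrite (lin_tlift (F := fun u => _ * u)); last by linearity.
  by apply: eq_tlift => c d; rewrite -scalerAl -scalerAr.
rewrite E -?E'; try by linearity.
rewrite /hepsL /coactr (lin_tlift (F := fun u => hepsR psi * u)); last by linearity.
apply: eq_tlift => a b; rewrite /hepsR /coactl.
rewrite (lin_tlift (F := fun u => u * (⟨phi|a⟩ *: b))); last by linearity.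
by apply: eq_tlift => c d; rewrite -scalerAr -scalerAl.
Qed.

Lemma epstE x : epst x = hepsL (epsR x).
Proof.
by rewrite /epst (wh_antipoder wH); apply: eq_tlift => a b; rewrite actlE dual_oneE.
Qed.

Lemma epssE x : epss x = hepsR (epsL x).
Proof.
by rewrite /epss (wh_antipodel wH); apply: eq_tlift => a b; rewrite actrE dual_oneE.
Qed.

Lemma epst_A_L x : epst x \in A_L H.
Proof. by apply/A_LP; exists (epsR x); rewrite epstE. Qed.

Lemma epss_A_R x : epss x \in A_R H.
Proof. by apply/A_RP; exists (epsL x); rewrite epssE. Qed.

Lemma epst1 : epst 1 = 1.
Proof.
rewrite /epst (wh_antipoder wH) -[RHS]counitl.
by apply: eq_tlift => a b; rewrite mulr1.
Qed.

Lemma epss1 : epss 1 = 1.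
Proof.
rewrite /epss (wh_antipodel wH) -[RHS]counitr.
by apply: eq_tlift => a b; rewrite mul1r.
Qed.

Lemma epst_A_Ll z x : z \in A_L H -> epst (z * x) = z * epst x.
Proof.
move=> zA; rewrite /epst sw_A_Ll //; last by linearity.
rewrite [RHS]lin_tlift; last by linearity.
by apply: eq_tlift => a b; rewrite mulrA.
Qed.

Lemma epst_id z : z \in A_L H -> epst z = z.
Proof. by move=> zA; rewrite -[in LHS](mulr1 z) epst_A_Ll // epst1 mulr1. Qed.

(** The primed counit axiom with 1 in the middle reads ε(x y) = ε(x 1_(2)) ε(1_(1) y), and epst y =
    ε(1_(1) y) 1_(2). *)
Lemma counit_epst x y : counit (x * epst y) = counit (x * y).
Proof.
rewrite -[in RHS](mulr1 x) (wh_counit' wH) /epst (wh_antipoder wH).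
rewrite (lin_tlift (F := fun u => counit (x * u))); last by linearity.
apply: eq_tlift => a b; rewrite -scalerAr linearZ /=; exact: mulrC.
Qed.

Lemma counit_epss x y : counit (epss x * y) = counit (x * y).
Proof.
rewrite -[in RHS](mulr1 x) (wh_counit' wH) /epss (wh_antipodel wH).
rewrite (lin_tlift (F := fun u => counit (u * y))); last by linearity.
by apply: eq_tlift => a b; rewrite -scalerAl linearZ.
Qed.

(** By [counit_epst], y may be replaced by epst y, which lies in A_L and so multiplies only the
    first leg of Δ(x). *)
Lemma epst_mul x y : epst (x * y) = \sw_(a, b <- comul x) a * epst y * S b.
Proof.
transitivity (epst (x * epst y)).
  rewrite [LHS](wh_antipoder wH) [RHS](wh_antipoder wH); apply: eq_tlift => a b.
  by rewrite !mulrA counit_epst.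
by rewrite {1}/epst sw_A_Lr ?epst_A_L //; linearity.
Qed.

Lemma epss_mul x y : epss (x * y) = \sw_(a, b <- comul y) S a * epss x * b.
Proof.
transitivity (epss (epss x * y)).
  rewrite [LHS](wh_antipodel wH) [RHS](wh_antipodel wH); apply: eq_tlift => a b.
  by rewrite -!mulrA counit_epss.
rewrite {1}/epss sw_A_Rl ?epss_A_R //; last by linearity.
by apply: eq_tlift => a b; rewrite mulrA.
Qed.

Lemma antipode_epst x : \sw_(a, b <- comul x) S a * epst b = S x.
Proof.
rewrite -(wh_antipode_mid wH) (sw_coassoc (f := fun a b c => S a * b * S c));
  try by linearity.
apply: eq_tlift => a b; rewrite /epst lin_tlift; last by linearity.
by apply: eq_tlift => c d; rewrite mulrA.
Qed.

Lemma antipode_epss x : \sw_(a, b <- comul x) epss a * S b = S x.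
Proof.
rewrite -(wh_antipode_mid wH).
apply: eq_tlift => a b; rewrite /epss (lin_tlift (F := fun u => u * _)) //.
by linearity.
Qed.

Lemma antipode1 : S 1 = 1.
Proof.
rewrite -antipode_epst -[RHS]epss1; apply: eq_sw1_A_L => [||a b bA].
- by rewrite /epst; linearity.
- by linearity.
- by rewrite epst_id.
Qed.

(** The convolution product of maps H ⊗ H → H, for the coproduct of H ⊗ H, evaluated at x ⊗ y. *)
Definition conv (F G : 'Hom(tens H H, H)) x y : H :=
  \sw_(a, b <- comul x) \sw_(c, d <- comul y) F (a ⊗ c) * G (b ⊗ d).

Lemma conv_bilin F G : bilin (conv F G).
Proof. by rewrite /conv; linearity. Qed.

Lemma convA (F G J : 'Hom(tens H H, H)) x y :
  conv (linfun (tlift (conv F G))) J x y = conv F (linfun (tlift (conv G J))) x y.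
Proof.
transitivity (\sw_(a, b <- comul x) \sw_(p, q <- comul a)
    \sw_(c, d <- comul y) \sw_(r, s <- comul c) F (p ⊗ r) * G (q ⊗ s) * J (b ⊗ d)).
  apply: eq_tlift => a b; rewrite [RHS]tlift_exchange; apply: eq_tlift => c d.
  rewrite lfunE /= tlift_pure; last exact: conv_bilin.
  rewrite /conv (lin_tlift (F := fun u => u * _)); last by linearity.
  by apply: eq_tlift => p q; rewrite (lin_tlift (F := fun u => u * _)) //; linearity.
rewrite (sw_coassoc (f := fun p q b => \sw_(c, d <- comul y)
  \sw_(r, s <- comul c) F (p ⊗ r) * G (q ⊗ s) * J (b ⊗ d))); try by linearity.
apply: eq_tlift => a b.
transitivity (\sw_(p, q <- comul b) \sw_(c, d <- comul y)
  \sw_(r, s <- comul d) F (a ⊗ c) * G (p ⊗ r) * J (q ⊗ s)).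
  apply: eq_tlift => p q.
  by rewrite (sw_coassoc (f := fun r s d => F (a ⊗ r) * G (p ⊗ s) * J (q ⊗ d))) //; linearity.
rewrite tlift_exchange; apply: eq_tlift => c d.
rewrite lfunE /= tlift_pure; last exact: conv_bilin.
rewrite /conv (lin_tlift (F := fun u => _ * u)); last by linearity.
apply: eq_tlift => p q; rewrite (lin_tlift (F := fun u => _ * u)); last by linearity.
by apply: eq_tlift => r s; rewrite mulrA.
Qed.

End ElementaryTheory.

(** * The antipode and its inverse *)

Section Antipode.
Variables (K : numClosedFieldType) (H : preHopfType K) (wH : weak_hopf H).
Implicit Types (x y z w : H) (phi : dual H).
Local Notation S := (antipode : 'End(H)).
Local Notation Sinv := (antipode_inv H).

Lemma linfun_tlift (g : H -> H -> H) a b :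
  bilin g -> linfun (tlift g) (a ⊗ b) = g a b.
Proof. by move=> bg; rewrite lfunE /= tlift_pure. Qed.

(* Both (x, y) ↦ S(xy) and (x, y) ↦ S(y)S(x) are convolution quasi-inverses of
   the multiplication with the same source and target projections. *)
Lemma antipodeM x y : S (x * y) = S y * S x.
Proof.
pose M := linfun (tlift (fun a b : H => a * b)).
pose P := linfun (tlift (fun a b : H => S (a * b))).
pose Q := linfun (tlift (fun a b : H => S b * S a)).
have Me a b : M (a ⊗ b) = a * b by apply: linfun_tlift; linearity.
have Pe a b : P (a ⊗ b) = S (a * b) by apply: linfun_tlift; linearity.
have Qe a b : Q (a ⊗ b) = S b * S a by apply: linfun_tlift; linearity.
have PM a b : conv P M a b = epss (a * b).
  rewrite /epss sw_comulM //; last by linearity.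
  by do 2!apply: eq_tlift => ? ?; rewrite Me Pe.
have MP a b : conv M P a b = epst (a * b).
  rewrite /epst sw_comulM //; last by linearity.
  by do 2!apply: eq_tlift => ? ?; rewrite Me Pe.
have MQ a b : conv M Q a b = epst (a * b).
  rewrite epst_mul //; apply: eq_tlift => c d; rewrite /epst.
  rewrite (lin_tlift (F := fun u => c * u * S d)); last by linearity.
  by apply: eq_tlift => p q; rewrite Me Qe !mulrA.
have QM a b : conv Q M a b = epss (a * b).
  rewrite epss_mul // /conv tlift_exchange; apply: eq_tlift => c d; rewrite /epss.
  rewrite (lin_tlift (F := fun u => S c * u * d)); last by linearity.
  by apply: eq_tlift => p q; rewrite Me Qe !mulrA.
have PMP : conv P (linfun (tlift (conv M P))) x y = S (x * y).
  rewrite -(antipode_epst wH (x * y)) sw_comulM //; last by rewrite /epst; linearity.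
  do 2!apply: eq_tlift => ? ?.
  by rewrite Pe linfun_tlift ?MP //; exact: conv_bilin.
(* The left side collapses to S(y_(1)) epss(x_(1)) epst(y_(2)) S(x_(2)). The two middle factors
   commute, lying in A_R and A_L, and after the exchange the sums over x and y separate. *)
have QMQ : conv (linfun (tlift (conv Q M))) Q x y = S y * S x.
  transitivity (\sw_(a, b <- comul x) \sw_(c, d <- comul y)
      S c * epst d * (epss a * S b)).
    apply: eq_tlift => a b.
    transitivity (\sw_(c, d <- comul y) \sw_(p, q <- comul c)
        S p * epss a * q * S d * S b).
      apply: eq_tlift => c d; rewrite linfun_tlift; last exact: conv_bilin.
      rewrite QM epss_mul // Qe mulrA.
      rewrite (lin_tlift (F := fun u => u * S d * S b)) //; by linearity.
    rewrite (sw_coassoc (f := fun p q d => S p * epss a * q * S d * S b));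
      try by linearity.
    apply: eq_tlift => c d; rewrite -(mulrA (S c)) [epst d * _]mulrA.
    rewrite (A_LR_comm wH (epst_A_L wH d) (epss_A_R wH a)) /epst.
    rewrite (lin_tlift (F := fun u => S c * (epss a * u * S b))); last by linearity.
    by apply: eq_tlift => p q; rewrite !mulrA.
  rewrite tlift_exchange -[S y](antipode_epst wH).
  rewrite (lin_tlift (F := fun u => u * S x)); last by linearity.
  apply: eq_tlift => c d; rewrite -[S x in RHS](antipode_epss wH).
  by rewrite (lin_tlift (F := fun u => S c * epst d * u)) //; linearity.
rewrite -PMP -QMQ.
transitivity (conv P (linfun (tlift (conv M Q))) x y).
  do 2!apply: eq_tlift => ? ?; congr (_ * _).
  by rewrite !linfun_tlift ?MP ?MQ //; exact: conv_bilin.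
rewrite -convA; do 2!apply: eq_tlift => ? ?; congr (_ * _).
by rewrite !linfun_tlift ?PM ?QM //; exact: conv_bilin.
Qed.

(** From 1 = 1_(1) S(1_(2)) one gets S(w) = 1_(1) S(w 1_(2)), and 1_(1) ⊗ w 1_(2) is Δ(w). *)
Lemma antipode_A_R w : w \in A_R H -> S w = epst w.
Proof.
move=> wA; rewrite -[w in RHS]mulr1 /epst sw_A_Rl //; last by linearity.
rewrite -[LHS]mul1r -[1 in LHS](epst1 wH) /epst.
rewrite (lin_tlift (F := fun u => u * S w)); last by linearity.
by apply: eq_tlift => a b; rewrite antipodeM mulrA.
Qed.

(** In epst x = ε(1'_(1) x) 1'_(2), a 1 inserted before x splits the scalar into ε(1'_(1) 1_(1))
    ε(1_(2) x). The primed sum is then epst(1_(1)), which equals S(1_(1)) because 1_(1) lies in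
    A_R. *)
Lemma epst_antipode x : epst x = S (hepsR (epsR x)).
Proof.
rewrite /hepsR /coactl (lin_tlift (F := S)); last by linearity.
transitivity (\sw_(a, b <- comul (1 : H)) (counit (b * x) : K) *: epst a).
  transitivity (\sw_(a, b <- comul (1 : H)) \sw_(c, d <- comul (1 : H))
    (counit (b * x) : K) *: ((counit (c * a) : K) *: d)).
    rewrite tlift_exchange [LHS](wh_antipoder wH); apply: eq_tlift => c d.
    rewrite -[c * x]/(c * x) -{1}[c]mulr1 (wh_counit wH).
    rewrite (lin_tlift (F := fun u : K^o => (u : K) *: d)); last by linearity.
    by apply: eq_tlift => a b; rewrite !scalerA mulrC.
  apply: eq_tlift => a b; rewrite /epst (wh_antipoder wH).
  by rewrite -lin_tlift //; linearity.
apply: (eq_sw1_A_R (H := H)) => [||a b aA].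
- by rewrite /epst; linearity.
- by rewrite /epsR /actl; linearity.
- by rewrite linearZ /= actlE dual_oneE antipode_A_R.
Qed.

Hypothesis S_surj : forall x, exists y, S y = x.

Lemma antipode_inj : injective S.
Proof.
have imS : limg S = fullv.
  apply/eqP; rewrite eqEsubv subvf /=; apply/subvP => x _.
  by have [y <-] := S_surj x; apply: memv_img; rewrite memvf.
have := limg_ker_dim S fullv; rewrite capfv imS => /eqP.
rewrite -[X in _ == X]add0n eqn_add2r dimv_eq0 => /eqP kerS.
by apply/lker0P; rewrite kerS.
Qed.

Lemma antipodeK : cancel S Sinv.
Proof. by move=> x; apply: lker0_lfunK; apply/lker0P; exact: antipode_inj. Qed.

Lemma antipode_invK : cancel Sinv S.
Proof. by move=> x; have [y <-] := S_surj x; rewrite antipodeK. Qed.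

Lemma antipode_invM x y : Sinv (x * y) = Sinv y * Sinv x.
Proof. by apply: antipode_inj; rewrite antipodeM !antipode_invK. Qed.

(** S turns x_(2) S^-1(x_(1)) into x_(1) S(x_(2)) = epst x, to which [epst_antipode] applies. So
    [nR x] depends on x only through [epsR x]. *)
Lemma nR_hepsR x : nR x = hepsR (epsR x).
Proof.
apply: antipode_inj; rewrite -epst_antipode /nR (lin_tlift (F := S)); last by linearity.
by apply: eq_tlift => a b; rewrite antipodeM antipode_invK.
Qed.

Lemma antipode_nR x : S (nR x) = epst x.
Proof. by rewrite nR_hepsR epst_antipode. Qed.

Lemma nR_A_R x : nR x \in A_R H.
Proof. by apply/A_RP; exists (epsR x); rewrite nR_hepsR. Qed.

Lemma antipode_A_LR z : z \in A_L H -> z \in A_R H -> S z = z.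
Proof. by move=> zL zR; rewrite antipode_A_R // epst_id. Qed.

(** * Left integrals and the map E *)

Section LeftIntegral.
Variable l : H.
Hypothesis hl : left_integral l.

(** Write S(x) = S(x_(1)) epst(x_(2)) on the right. As epst(x_(2)) l = x_(2) l, the right side is
    S(x_(1)) x_(2) l_(1) ⊗ x_(3) l_(2), that is 1_(1) l_(1) ⊗ ε(x_(1) 1_(2)) x_(2) l_(2). The scalar
    reassembles to x 1_(2), and Δ(1)Δ(l) = Δ(l). *)
Lemma left_integral_slide (W : lmodType K) (f : H -> H -> W) x : bilin f ->
  \sw_(a, b <- comul l) f a (x * b) = \sw_(a, b <- comul l) f (S x * a) b.
Proof.
move=> bf.
transitivity (\sw_(p, q <- comul x) \sw_(a, b <- comul (q * l)) f (S p * a) b); last first.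
  transitivity (\sw_(p, q <- comul x) \sw_(a, b <- comul l) f (S p * epst q * a) b).
    apply: eq_tlift => p q; rewrite hl -/(epst q) sw_A_Ll ?epst_A_L //; last by linearity.
    by apply: eq_tlift => a b; rewrite mulrA.
  rewrite tlift_exchange; apply: eq_tlift => a b.
  rewrite -[in RHS](antipode_epst wH).
  by rewrite (lin_tlift (F := fun u => f (u * a) b)) //; linearity.
transitivity (\sw_(p, q <- comul x) \sw_(c, d <- comul p) \sw_(a, b <- comul l)
    f (S c * d * a) (q * b)); last first.
  rewrite (sw_coassoc (f := fun c d q => \sw_(a, b <- comul l) f (S c * d * a) (q * b)));
    try by linearity.
  apply: eq_tlift => p q; rewrite sw_comulM //; last by linearity.
  by do 2!apply: eq_tlift => ? ?; rewrite mulrA.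
transitivity (\sw_(p, q <- comul x) \sw_(u, v <- comul (1 : H)) \sw_(a, b <- comul l)
    (counit (p * v) : K) *: f (u * a) (q * b)); last first.
  apply: eq_tlift => p q; rewrite tlift_exchange [RHS]tlift_exchange.
  apply: eq_tlift => a b.
  rewrite -(lin_tlift (F := fun u => f (u * a) (q * b))); last by linearity.
  rewrite (wh_antipodel wH) (lin_tlift (F := fun u => f (u * a) (q * b))); last by linearity.
  by apply: eq_tlift => u v; rewrite -scalerAl (linear_scale _ _ (bf.1 _)).
rewrite tlift_exchange -{1}(mul1r l) sw_comulM //; last by linearity.
apply: (eq_sw1_A_L (H := H)) => [||u v vA]; try by linearity.
rewrite tlift_exchange; apply: eq_tlift => a b.
rewrite mulrA -(counit_A_Lr wH _ vA).
rewrite (lin_tlift (F := fun t => f (u * a) (t * b))); last by linearity.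
by apply: eq_tlift => p q; rewrite -scalerAl (linear_scale _ _ (bf.2 _)).
Qed.

Variable lam : dual H.
Local Notation E := (hatE_ lam).
Hypotheses (E_A_L : forall x, E x \in A_L H)
  (lam_nondeg : forall x, (forall y, ⟨lam|y * x⟩ = 0) -> x = 0)
  (l_lam : E l = 1).

Lemma hatE_linear : linear E.
Proof. by rewrite /hatE_ /coactl; linearity. Qed.

Lemma hatE_A_Ll z x : z \in A_L H -> E (z * x) = z * E x.
Proof.
move=> zA; rewrite /hatE_ /coactl sw_A_Ll //; last by linearity.
rewrite (lin_tlift (F := fun u => z * u)); last by linearity.
by apply: eq_tlift => a b; rewrite scalerAr.
Qed.

Lemma hatE_A_Lr z x : z \in A_L H -> E (x * z) = E x * z.
Proof.
move=> zA; rewrite /hatE_ /coactl sw_A_Lr //; last by linearity.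
rewrite (lin_tlift (F := fun u => u * z)); last by linearity.
by apply: eq_tlift => a b; rewrite scalerAl.
Qed.

(** This makes E inherit the nondegeneracy of λ, in [hatE_nondeg]. *)
Lemma counit_hatE x : counit (E x) = ⟨lam|x⟩.
Proof.
rewrite /hatE_ /coactl (lin_tlift (F := counit)); last by linearity.
rewrite -[in RHS](counitl x) (lin_tlift (F := dpair lam : H -> K^o)); last by exact: dpair_linr.
apply: eq_tlift => a b; rewrite linearZ (linear_scale _ _ (dpair_linr lam)) /=.
exact: mulrC.
Qed.

Lemma hatE_nondeg x : (forall y, E (y * x) = 0) -> x = 0.
Proof. by move=> Ex; apply: lam_nondeg => y; rewrite -counit_hatE Ex linear0. Qed.

(** Both x_(1) ⊗ E(x_(2)) and Δ(E(x)) are x_(1) ⊗ x_(2) ⟨λ|x_(3)⟩. For x = l this tensor is Δ(1). *)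
Lemma sw_hatE (W : lmodType K) (f : H -> H -> W) x : bilin f ->
  \sw_(a, b <- comul x) f a (E b) = tlift f (comul (E x)).
Proof.
move=> bf; rewrite /hatE_ /coactl.
transitivity (\sw_(a, b <- comul x) \sw_(c, d <- comul b) ⟨lam|d⟩ *: f a c).
  apply: eq_tlift => a b; rewrite (lin_tlift (F := f a)); last exact: bf.2.
  by apply: eq_tlift => c d; rewrite (linear_scale _ _ (bf.2 _)).
rewrite -(sw_coassoc (f := fun c d b => ⟨lam|b⟩ *: f c d)); try by linearity.
rewrite (lin_tlift (F := fun t => tlift f (comul t))); last by linearity.
apply: eq_tlift => a b; rewrite linearZ linearZ /=.
by rewrite (lin_tlift (F := fun t => _ *: t)) //; linearity.
Qed.

Lemma qb_tensor_right x :
  tlift (fun u v => E (x * u) * v) (qb_tensor l) = x.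
Proof.
have lE (g : H -> H) : linear g -> linear (fun u => E (g u)).
  by move=> lg a u v; rewrite lg hatE_linear.
have bE : bilin (fun a b => E b * Sinv a).
  split=> u; first by linearity.
  by apply: lin_mull; exact: hatE_linear.
rewrite /qb_tensor (lin_tlift (F := tlift (fun u v => E (x * u) * v))); last exact: tlift_linear.
transitivity (\sw_(a, b <- comul l) E (x * b) * Sinv a).
  apply: eq_tlift => a b; rewrite tlift_pure //.
  split=> u; last by linearity.
  by apply: lin_mull; apply: lE; linearity.
rewrite (left_integral_slide x bE).
transitivity (\sw_(a, b <- comul l) E b * Sinv a * x).
  by apply: eq_tlift => a b; rewrite antipode_invM antipodeK mulrA.
rewrite -(lin_tlift (F := fun u => u * x)); last by linearity.
rewrite (sw_hatE (f := fun a b => b * Sinv a)); last by linearity.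
rewrite l_lam -/(nR 1) (_ : nR 1 = 1) ?mul1r //.
by apply: antipode_inj; rewrite antipode_nR epst1 // antipode1.
Qed.

End LeftIntegral.
End Antipode.

(** * Quasi-bases and the index *)

Lemma watatani_indexE (K : fieldType) (B : falgType K) (F : B -> B) c :
  is_index F c -> watatani_index F = c.
Proof. by move=> Fc; apply: xget_unique => // d; move/is_index_uniq; apply. Qed.

(** In the sum of u_j (v_j b), expand v_j b as the sum over i of F(v_j b u_i) v_i. Summing over j
    first leaves the sum of b u_i v_i. *)
Lemma is_index_center (K : fieldType) (B : falgType K) (F : B -> B) c :
  is_index F c -> c \in 'Z({:B})%VS.
Proof.
move=> [n [u [v [uv ->]]]]; rewrite memv_cap memvf; apply/centvP => b _.
transitivity (\sum_i \sum_j u j * F (v j * (b * u i)) * v i).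
  rewrite exchange_big mulr_suml; apply: eq_bigr => j _ /=.
  rewrite -mulrA -[v j * b in LHS](uv (v j * b)).2 mulr_sumr.
  by apply: eq_bigr => i _; rewrite !mulrA.
rewrite mulr_sumr; apply: eq_bigr => i _.
by rewrite -mulr_suml (uv _).1 mulrA.
Qed.

Lemma tens_sum (K : fieldType) (U V : vectType K) (t : tens U V) :
  exists (n : nat) (u : 'I_n -> U) (v : 'I_n -> V), t = \sum_i u i ⊗ v i.
Proof. by eexists; eexists; eexists; exact: tens_coordl. Qed.

Section DualBases.
Variables (K : numClosedFieldType) (H : preHopfType K) (wH : weak_hopf H).
Hypothesis S_surj : forall x : H, exists y, antipode y = x.
Variables (l : H) (lam : dual H).
Local Notation E := (hatE_ lam).
Hypotheses (hl : left_integral l) (E_A_L : forall x, E x \in A_L H)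
  (lam_nondeg : forall x, (forall y, ⟨lam|y * x⟩ = 0) -> x = 0)
  (l_lam : E l = 1).

Lemma hatE_quasi_basis : tensor_quasi_basis E (qb_tensor l).
Proof.
have lE := hatE_linear lam.
move=> n u v uv; have bE x : bilin (fun a b => E (x * a) * b).
  split=> y; last by linearity.
  by apply: lin_mull => c s t /=; rewrite mulrDr -scalerAr lE.
have Er b : \sum_i E (b * u i) * v i = b.
  by rewrite -[RHS](qb_tensor_right wH S_surj hl l_lam) -uv tlift_sum.
move=> b; split=> //; apply/eqP; rewrite -subr_eq0; apply/eqP.
(* Test the missing identity with E(y ·). The bimodule property turns E(y u_i E(v_i b)) into E(E(y
   u_i) v_i b), and by [Er] these sum to E(y b). *)
apply: (hatE_nondeg lam_nondeg) => y.
rewrite mulrBr addrC -scaleN1r lE scaleN1r addrC.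
apply/eqP; rewrite subr_eq0; apply/eqP.
rewrite mulr_sumr (linear_sum1 _ _ lE).
rewrite -[in RHS](Er y) mulr_suml (linear_sum1 _ _ lE).
apply: eq_bigr => i _.
by rewrite mulrA (hatE_A_Lr wH) // -[X in _ = E X]mulrA [in RHS](hatE_A_Ll wH).
Qed.

Lemma hatE_index_finite : index_finite_type (A_L H) E.
Proof.
split=> //; have [n [u [v uv]]] := tens_sum (qb_tensor l).
by exists n, u, v; exact: hatE_quasi_basis.
Qed.

Lemma hatE_is_index : is_index E (nR l).
Proof.
have [n [u [v uv]]] := tens_sum (qb_tensor l).
exists n, u, v; split; first exact: hatE_quasi_basis.
have <- : tlift (fun a b => a * b) (qb_tensor l) = nR l.
  rewrite /qb_tensor (lin_tlift (F := tlift (fun u v => u * v))); last exact: tlift_linear.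
  by apply: eq_tlift => a b; rewrite tlift_pure //; linearity.
by rewrite uv tlift_sum //; linearity.
Qed.

Lemma hatIndE : hatInd lam = nR l.
Proof. exact: watatani_indexE hatE_is_index. Qed.

Lemma nR_mem : nR l \in (A_R H :&: 'Z({:H}))%VS.
Proof. by rewrite memv_cap nR_A_R //= (is_index_center hatE_is_index). Qed.

End DualBases.

(** * The bidual, and separation of tensors by functionals *)

Section Separation.
Variables (K : fieldType).

Definition ev_fun (V : vectType K) (x : V) (phi : dual V) : K^o := ⟨phi|x⟩.
HB.instance Definition _ (V : vectType K) (x : V) :=
  GRing.isLinear.Build K (dual V) K^o *:%R (ev_fun x) (dpair_linl x).
Definition ev (V : vectType K) (x : V) : dual (dual V) := linfun (ev_fun x).

Lemma evE (V : vectType K) (x : V) phi : ⟨ev x|phi⟩ = ⟨phi|x⟩.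
Proof. by rewrite /dpair lfunE. Qed.

Lemma ev_surj (V : vectType K) (Phi : dual (dual V)) : exists x, Phi = ev x.
Proof.
exists (\sum_(i < \dim {:V}) ⟨Phi|dcoord i⟩ *: (vbasis {:V})`_i).
apply: dualP => phi; rewrite evE {1}(dual_coord phi).
rewrite (linear_sumZ _ _ _ (dpair_linr Phi)) (linear_sumZ _ _ _ (dpair_linr phi)).
by apply: eq_bigr => i _; exact: mulrC.
Qed.

Lemma dual_sep (V : vectType K) (x y : V) :
  (forall phi : dual V, ⟨phi|x⟩ = ⟨phi|y⟩) -> x = y.
Proof.
move=> xy; rewrite (coord_vbasis (memvf x)) (coord_vbasis (memvf y)).
by apply: eq_bigr => i _; rewrite -!dcoordE xy.
Qed.

Variables (U V W : vectType K).

Lemma tens_sep (s t : tens U V) :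
  (forall (phi : dual U) (psi : dual V),
    \sw_(a, b <- s) ⟨phi|a⟩ *: (⟨psi|b⟩ : K^o) =
    \sw_(a, b <- t) ⟨phi|a⟩ *: (⟨psi|b⟩ : K^o)) -> s = t.
Proof.
move=> st; rewrite (tens_coordl s) (tens_coordl t).
apply: eq_bigr => i _; congr (_ ⊗ _); apply: dual_sep => psi.
rewrite !(lin_tlift _ _ (dpair_linr psi)).
apply: etrans (etrans _ (st (dcoord i) psi)) _; apply: eq_tlift => a b;
  by rewrite (linear_scale _ _ (dpair_linr psi)).
Qed.

Lemma tens3_sep (s t : tens (tens U V) W) :
  (forall (phi : dual U) (psi : dual V) (chi : dual W),
    let p a b c : K^o := ⟨phi|a⟩ *: (⟨psi|b⟩ *: (⟨chi|c⟩ : K^o)) in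
    \sw_(r, c <- s) \sw_(a, b <- r) p a b c =
    \sw_(r, c <- t) \sw_(a, b <- r) p a b c) -> s = t.
Proof.
move=> st; rewrite (tens_coordr s) (tens_coordr t).
apply: eq_bigr => i _; congr (_ ⊗ _); apply: tens_sep => phi psi.
pose F (r : tens U V) := \sw_(a, b <- r) ⟨phi|a⟩ *: (⟨psi|b⟩ : K^o).
have lF : linear F by rewrite /F; linearity.
have mulCA (u v w : K) : u * (v * w) = v * (w * u) by rewrite mulrCA (mulrC u).
rewrite -!/(F _) !(lin_tlift _ _ lF).
apply: etrans (etrans _ (st phi psi (dcoord i))) _; apply: eq_tlift => a b;
  rewrite (linear_scale _ _ lF) /F (lin_tlift (F := fun u : K^o => ⟨dcoord i|b⟩ *: u));
  try (by linearity); apply: eq_tlift => c d;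
  [exact: mulCA | exact: esym (mulCA _ _ _)].
Qed.

End Separation.

(** * Consequences of the star *)

Section CstarHopf.
Variables (K : numClosedFieldType) (A : weakCstarHopfType K).
Implicit Types (x y z : A).
Local Notation S := (antipode : 'End(A)).

(** J conjugates the coefficients of Δ(x), and the conjugated coefficients are those in [tstar],
    which computes Δ of [star x]. *)
Lemma sw_star (W W' : lmodType K) (J : W -> W') (g : A -> A -> W)
    (f : A -> A -> W') x :
  (forall c u v, J (c *: u + v) = c^* *: J u + J v) ->
  bilin f -> (forall a b, J (g a b) = f (star a) (star b)) ->
  J (tlift g (comul x)) = tlift f (comul (star x)).
Proof.
move=> aJ bf Jg; rewrite comul_star /tstar.
have J0 : J 0 = 0 by have := aJ (-1) 0 0; rewrite rmorphN1 !scaleN1r !addNr.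
have JD u v : J (u + v) = J u + J v by have := aJ 1 u v; rewrite rmorph1 !scale1r.
have JZ c u : J (c *: u) = c^* *: J u by have := aJ c u 0; rewrite J0 !addr0.
rewrite (linear_sum1 _ _ (tlift_linear f)) /tlift (big_morph J JD J0).
apply: eq_bigr => i _; rewrite -/(tlift f _) (linear_sumZ _ _ _ (tlift_linear f)).
rewrite (big_morph J JD J0).
by apply: eq_bigr => j _; rewrite JZ Jg tlift_pure.
Qed.

Lemma star1 : star (1 : A) = 1.
Proof. by rewrite -[LHS]mulr1 -{2}(starK (1 : A)) -starM mulr1 starK. Qed.

Lemma starZ (c : K) x : star (c *: x) = c^* *: star x.
Proof. by have := star_sumZ [:: tt] (fun=> c) (fun=> x); rewrite !big_seq1. Qed.

Lemma conj_antilinear (c : K) (u v : K^o) :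
  ((c *: u + v : K)^* : K^o) = c^* *: ((u : K)^* : K^o) + (v : K)^*.
Proof. by rewrite rmorphD rmorphM. Qed.

Lemma lin_conj (f : A -> K^o) :
  linear f -> linear (fun x => (f (star x) : K)^* : K^o).
Proof.
by move=> lf c x y; rewrite star_antilinear lf conj_antilinear conjCK.
Qed.

(** Conjugating ε at [star x] gives another left counit [f]; a left counit and a right counit agree,
    by evaluating f(x_(1)) ε(x_(2)) in two ways. *)
Lemma counit_star x : counit (star x) = (counit x : K)^*.
Proof.
pose f x := (counit (star x) : K)^* : K^o.
have lf : linear f by apply: lin_conj; linearity.
have fl y : \sw_(a, b <- comul y) (f a : K) *: b = y.
  rewrite -[RHS]starK -[star y]counitl.
  rewrite (sw_star (J := star) (f := fun a b => (f a : K) *: b)) ?starK //.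
  - exact: star_antilinear.
  - by split=> u; [apply: lin_scalel | linearity].
  - by move=> a b; rewrite starZ /f starK.
apply: (can_inj (@conjCK K)); rewrite conjCK -/(f x).
rewrite -[in LHS](counitr x) (lin_tlift _ _ lf) -[in RHS](fl x).
rewrite (lin_tlift (F := counit)); last by linearity.
apply: (eq_tlift (W := K^o)) => a b; rewrite (linear_scale _ _ lf) linearZ /=.
exact: mulrC.
Qed.

Lemma cstar_counitM x y z : counit (x * y * z) =
  \sw_(a, b <- comul y) (counit (x * a) : K) *: counit (b * z).
Proof. exact: counit_weakM. Qed.

(** The star reverses the product x y z but keeps the legs of Δ(y) in order, so the axiom comes back
    with its legs exchanged. *)
Lemma cstar_counitM' x y z : counit (x * y * z) =
  \sw_(a, b <- comul y) (counit (x * b) : K) *: counit (a * z).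
Proof.
rewrite -[x * y * z]starK counit_star !starM mulrA cstar_counitM.
rewrite (sw_star (J := fun u : K^o => (u : K)^* : K^o)
  (f := fun a b => (counit (x * b) : K) *: counit (a * z))) ?starK //.
- exact: conj_antilinear.
- by linearity.
- move=> a b; rewrite -{1}[a]starK -{1}[b]starK -!starM !counit_star.
  have conjM (u v : K) : (u^* * v^*)^* = v * u by rewrite rmorphM /= !conjCK mulrC.
  exact: conjM.
Qed.

Lemma cstar_comul1 :
  \sw_(a, b <- comul (1 : A)) \sw_(c, d <- comul (1 : A)) (a ⊗ (b * c) ⊗ d) =
  \sw_(a, b <- comul 1) \sw_(c, d <- comul b) (a ⊗ c ⊗ d).
Proof.
have tassocE (u : A) (t : tens A A) :
    tassoc A A A (u ⊗ t) = \sw_(c, d <- t) (u ⊗ c ⊗ d).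
  rewrite -[in LHS](tlift_id t) (lin_tlift (F := fun s => tassoc A A A (u ⊗ s))).
    by apply: eq_tlift => c d; rewrite tassoc_pure.
  by linearity.
have := comul_weak1 (s := A); rewrite comul_coassoc => E.
apply: etrans (etrans _ E) _.
  rewrite tassocE -[X in X ⊗ 1](tlift_id (comul 1)).
  rewrite (lin_tlift (F := fun s => (s ⊗ 1) * _)); last by linearity.
  apply: eq_tlift => a b; rewrite (lin_tlift (F := fun s => _ * s)); last by linearity.
  by apply: eq_tlift => c d; rewrite !tens_mulE mulr1 !mul1r.
rewrite [tmap _ _ _]lfunE /= (lin_tlift (F := tassoc A A A)); last by linearity.
by apply: eq_tlift => a b; rewrite id_lfunE tassocE.
Qed.

(** Applying the star to [cstar_comul1] reverses the middle product. This is done on scalars: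
    tensors are tested against φ ⊗ ψ ⊗ χ, the conjugated test form is the trilinear [q], and
    [sw_star] undoes the conjugation one coproduct at a time. *)
Lemma cstar_comul1' :
  \sw_(a, b <- comul (1 : A)) \sw_(c, d <- comul (1 : A)) (a ⊗ (c * b) ⊗ d) =
  \sw_(a, b <- comul 1) \sw_(c, d <- comul b) (a ⊗ c ⊗ d).
Proof.
apply: tens3_sep => phi psi chi p.
pose F (t : tens (tens A A) A) := \sw_(r, c <- t) \sw_(a, b <- r) p a b c.
have lF : linear F by rewrite /F /p; linearity.
rewrite -!/(F _) !(lin_tlift _ _ lF).
have bp c : bilin (fun a b => p a b c) by rewrite /p; linearity.
have Fp a b c : F (a ⊗ b ⊗ c) = p a b c.
  by rewrite /F !tlift_pure //; rewrite /p; linearity.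
transitivity (\sw_(a, b <- comul (1 : A)) \sw_(c, d <- comul (1 : A)) p a (c * b) d).
  apply: eq_tlift => a b; rewrite (lin_tlift _ _ lF).
  by apply: eq_tlift => c d; rewrite Fp.
transitivity (\sw_(a, b <- comul (1 : A)) \sw_(c, d <- comul b) p a c d); last first.
  apply: eq_tlift => a b; rewrite (lin_tlift _ _ lF).
  by apply: eq_tlift => c d; rewrite Fp.
pose q a b c : K^o := (p (star a) (star b) (star c) : K)^*.
have q1 b c : linear (fun a => q a b c).
  by apply: (lin_conj (f := fun a => p a (star b) (star c))); rewrite /p; linearity.
have q2 a c : linear (fun b => q a b c).
  by apply: (lin_conj (f := fun b => p (star a) b (star c))); rewrite /p; linearity.
have q3 a b : linear (q a b).
  by apply: (lin_conj (f := fun c => p (star a) (star b) c)); rewrite /p; linearity.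
have E := sw_trilinear q1 q2 q3 cstar_comul1.
have qK a b c : (q a b c : K)^* = p (star a) (star b) (star c) by exact: conjCK.
pose J (u : K^o) : K^o := (u : K)^*.
apply: etrans (etrans _ (congr1 J E)) _.
  rewrite -[in LHS]star1; apply: esym; apply: sw_star => [||a b].
  - exact: conj_antilinear.
  - by rewrite /p; linearity.
  apply: sw_star => [||c d].
  - exact: conj_antilinear.
  - by rewrite /p; linearity.
  by rewrite /J qK starM.
rewrite -[in RHS]star1; apply: sw_star => [||a b].
- exact: conj_antilinear.
- by rewrite /p; linearity.
apply: sw_star => [||c d].
- exact: conj_antilinear.
- by rewrite /p; linearity.
by rewrite /J qK.
Qed.

Lemma cstar_weak_hopf : weak_hopf A.
Proof.
split.
- exact: comulM.
- exact: cstar_comul1.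
- exact: cstar_comul1'.
- exact: cstar_counitM.
- exact: cstar_counitM'.
- exact: antipodel.
- exact: antipoder.
- exact: antipode_mid.
Qed.

Let wA := cstar_weak_hopf.

(* T is the antipode of the opposite algebra; it is shown to be a right inverse
   of S. *)
Let T x := star (S (star x)).

Let T_linear : linear T.
Proof. by move=> c x y; rewrite /T star_antilinear linearP star_antilinear conjCK. Qed.

Let lin_T (f : A -> A) : linear f -> linear (fun x => T (f x)).
Proof. by move=> lf c x y; rewrite lf T_linear. Qed.

Let T_epst x : \sw_(a, b <- comul x) T b * a =
  \sw_(a, b <- comul 1) (counit (x * a) : K) *: b.
Proof.
transitivity (star (epst (star x))).
  rewrite -{1}[x]starK; apply: esym; apply: sw_star => [||a b].
  - exact: star_antilinear.
  - by split=> u; [linearity | apply: lin_mull; apply: lin_T; linearity].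
  - by rewrite /T starK starM.
rewrite /epst (wh_antipoder wA) -[in RHS]star1; apply: sw_star => [||a b].
- exact: star_antilinear.
- by linearity.
- by rewrite starZ -counit_star starM starK.
Qed.

Let T_epss x : star (epss (star x)) = hepsR (epsR x).
Proof.
rewrite /epss (wh_antipodel wA) /hepsR /coactl -[in RHS]star1; apply: sw_star => [||a b].
- exact: star_antilinear.
- by linearity.
- by rewrite starZ -counit_star starM starK actlE dual_oneE.
Qed.

Let T_mid x : \sw_(a, b <- comul x) T b * hepsR (epsR a) = T x.
Proof.
rewrite {2}/T -(antipode_epss wA) -{1}[x]starK; apply: esym; apply: sw_star => [||a b].
- exact: star_antilinear.
- split=> u; last by apply: lin_mull; apply: lin_T; linearity.
  by apply: lin_mulr => c y z; rewrite !linearP.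
- by rewrite /T starK starM -T_epss starK.
Qed.

(** [T_mid] and antimultiplicativity give S(T x) = epst(x_(1)) S(T(x_(2))) = x_(1) S(T(x_(3))
    x_(2)). By [T_epst] this is ε(x_(2) 1_(1)) x_(1) S(1_(2)) = x 1_(1) S(1_(2)) = x. *)
Lemma cstar_antipode_surj x : exists y, S y = x.
Proof.
exists (T x); rewrite -T_mid (lin_tlift (F := S)); last by linearity.
transitivity (\sw_(a, b <- comul x) \sw_(c, d <- comul a) c * S d * S (T b)).
  apply: eq_tlift => a b; rewrite (antipodeM wA) -(epst_antipode wA) /epst.
  by rewrite (lin_tlift (F := fun u => u * _)) //; linearity.
have lST (f : A -> A) : linear f -> linear (fun x => S (T (f x))).
  by move=> lf c y z; rewrite lin_T // linearP.
rewrite (sw_coassoc (f := fun c d b => c * S d * S (T b))); try by linearity.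
transitivity (\sw_(a, b <- comul x) \sw_(u, v <- comul (1 : A))
   (counit (b * u) : K) *: (a * S v)).
  apply: eq_tlift => a b.
  transitivity (a * S (\sw_(u, v <- comul (1 : A)) (counit (b * u) : K) *: v)).
    rewrite -T_epst (lin_tlift (F := fun u => a * S u)); last by linearity.
    by apply: eq_tlift => c d; rewrite (antipodeM wA) mulrA.
  rewrite (lin_tlift (F := fun u => a * S u)); last by linearity.
  by apply: eq_tlift => c d; rewrite linearZ /= scalerAr.
rewrite tlift_exchange -[RHS]mulr1 -[X in _ = x * X](epst1 wA) /epst.
rewrite (lin_tlift (F := fun u => x * u)); last by linearity.
apply: (eq_sw1_A_R (H := A)) => [||u v uA]; try by linearity.
rewrite mulrA -(counit_A_Rr wA _ uA) (lin_tlift (F := fun t => t * S v)); last by linearity.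
by apply: eq_tlift => a b; rewrite scalerAl.
Qed.

End CstarHopf.

(** * The dual satisfies the same axioms *)

Section Dual.
Variables (K : numClosedFieldType) (H : preHopfType K) (wH : weak_hopf H).
Local Notation D := (dual H).
Local Notation S := (antipode : 'End(H)).
Implicit Types (x y z : H) (phi psi chi : D).

Lemma sw_dual_comul phi x y :
  \sw_(a, b <- comul phi) ⟨a|x⟩ *: (⟨b|y⟩ : K^o) = ⟨phi|x * y⟩.
Proof. exact: dual_comulE. Qed.

Lemma dpair_mul phi psi x :
  ⟨phi * psi|x⟩ = \sw_(a, b <- comul x) ⟨phi|a⟩ *: (⟨psi|b⟩ : K^o).
Proof. exact: dual_mulE. Qed.

Lemma dpair_sw (U V : vectType K) (f : U -> V -> D) t x :
  ⟨tlift f t|x⟩ = \sw_(a, b <- t) (⟨f a b|x⟩ : K^o).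
Proof. by rewrite (lin_tlift (F := fun phi : D => ⟨phi|x⟩ : K^o)) //; linearity. Qed.

Lemma dpairr_sw (U V : vectType K) (f : U -> V -> H) t phi :
  ⟨phi|tlift f t⟩ = \sw_(a, b <- t) (⟨phi|f a b⟩ : K^o).
Proof. by rewrite (lin_tlift (F := fun x => ⟨phi|x⟩ : K^o)) //; linearity. Qed.

Lemma dpairZr phi c x : ⟨phi|c *: x⟩ = c * ⟨phi|x⟩.
Proof. exact: (linear_scale _ _ (dpair_linr phi)). Qed.

Lemma dpairZl phi c x : ⟨c *: phi|x⟩ = c * ⟨phi|x⟩.
Proof. exact: (linear_scale _ _ (dpair_linl x)). Qed.

Lemma swZr (U V : vectType K) (f : U -> V -> K^o) t (c : K) :
  c *: tlift f t = \sw_(a, b <- t) c *: f a b.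
Proof. by rewrite (lin_tlift (F := fun u : K^o => c *: u)) //; linearity. Qed.

Lemma swZl (U V : vectType K) (f : U -> V -> K^o) t (c : K^o) :
  (tlift f t : K) *: c = \sw_(a, b <- t) (f a b : K) *: c.
Proof. by rewrite (lin_tlift (F := fun u : K^o => (u : K) *: c)) //; linearity. Qed.

(** Evaluated at x ⊗ y, this is multiplicativity of Δ on [H] read through the pairing; the work is
    in reordering four Sweedler sums. *)
Lemma dual_comulM phi psi : comul (phi * psi) = comul phi * comul psi.
Proof.
apply: tens_sep => Phi Psi; have [x ->] := ev_surj Phi; have [y ->] := ev_surj Psi.
rewrite sw_mul; last by linearity.
transitivity (\sw_(p, q <- comul x) \sw_(r, s <- comul y)
  ⟨phi|p * r⟩ *: (⟨psi|q * s⟩ : K^o)).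
  under eq_tlift => a b do rewrite !evE.
  rewrite sw_dual_comul dpair_mul (sw_comulM wH) //.
  by linearity.
transitivity (\sw_(p, q <- comul x) \sw_(a, b <- comul phi)
  \sw_(r, s <- comul y) \sw_(c, d <- comul psi)
  ⟨a|p⟩ *: (⟨c|q⟩ *: (⟨b|r⟩ *: (⟨d|s⟩ : K^o)))).
  apply: eq_tlift => p q; rewrite [RHS]tlift_exchange; apply: eq_tlift => r s.
  rewrite -!sw_dual_comul swZl; apply: eq_tlift => a b.
  rewrite swZr; apply: eq_tlift => c d; rewrite !scalerA; congr (_ *: _).
  by rewrite -!mulrA [⟨b|r⟩ * _]mulrC.
rewrite tlift_exchange; apply: eq_tlift => a b.
transitivity (\sw_(p, q <- comul x) \sw_(c, d <- comul psi)
  \sw_(r, s <- comul y)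
  ⟨a|p⟩ *: (⟨c|q⟩ *: (⟨b|r⟩ *: (⟨d|s⟩ : K^o)))).
  by apply: eq_tlift => p q; rewrite tlift_exchange.
rewrite tlift_exchange; apply: eq_tlift => c d.
rewrite !evE !dpair_mul swZl; apply: eq_tlift => p q.
by rewrite -scalerA !swZr; apply: eq_tlift => r s.
Qed.

Let p3 x y z (a b c : D) : K^o := ⟨a|x⟩ *: (⟨b|y⟩ *: (⟨c|z⟩ : K^o)).

(** Paired with x ⊗ y ⊗ z, the iterated coproduct of the unit of the dual is ε(x y z). The counit
    axioms of [H] thus become the weak-unit axioms here, and conversely in [dual_counitM]. *)
Let dual_comul1_gen (op : D -> D -> D) :
  (forall x y z, \sw_(a, b <- comul (1 : D)) \sw_(c, d <- comul (1 : D))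
    p3 x y z a (op b c) d = counit (x * y * z)) ->
  \sw_(a, b <- comul (1 : D)) \sw_(c, d <- comul (1 : D)) (a ⊗ op b c ⊗ d) =
  \sw_(a, b <- comul 1) \sw_(c, d <- comul b) (a ⊗ c ⊗ d).
Proof.
move=> opE; apply: tens3_sep => Phi Psi Chi.
have [x ->] := ev_surj Phi; have [y ->] := ev_surj Psi.
have [z ->] := ev_surj Chi => p.
have pE a b c : p a b c = p3 x y z a b c by rewrite /p !evE.
pose F (t : tens (tens D D) D) := \sw_(r, c <- t) \sw_(a, b <- r) p a b c.
have lF : linear F by rewrite /F /p; linearity.
rewrite -!/(F _) !(lin_tlift _ _ lF).
have Fp a b c : F (a ⊗ b ⊗ c) = p3 x y z a b c.
  by rewrite /F !tlift_pure -?pE //; rewrite /p; linearity.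
transitivity (counit (x * y * z)).
  rewrite -opE; apply: eq_tlift => a b; rewrite (lin_tlift _ _ lF).
  by apply: eq_tlift => c d; rewrite Fp.
rewrite -dual_oneE -mulrA -sw_dual_comul; apply: eq_tlift => a b.
rewrite (lin_tlift _ _ lF) -sw_dual_comul swZr.
by apply: eq_tlift => c d; rewrite Fp.
Qed.

Lemma dual_comul1 :
  \sw_(a, b <- comul (1 : D)) \sw_(c, d <- comul (1 : D)) (a ⊗ (b * c) ⊗ d) =
  \sw_(a, b <- comul 1) \sw_(c, d <- comul b) (a ⊗ c ⊗ d).
Proof.
apply: dual_comul1_gen => x y z; rewrite (wh_counit wH).
transitivity (\sw_(a, b <- comul (1 : D)) \sw_(p, q <- comul y) \sw_(c, d <- comul (1 : D))
  ⟨a|x⟩ *: (⟨b|p⟩ *: (⟨c|q⟩ *: (⟨d|z⟩ : K^o)))).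
  apply: eq_tlift => a b; rewrite [RHS]tlift_exchange; apply: eq_tlift => c d.
  rewrite /p3 dpair_mul swZl swZr; apply: eq_tlift => p q.
  by rewrite -scalerA.
rewrite tlift_exchange; apply: eq_tlift => p q.
rewrite -!dual_oneE -!sw_dual_comul swZl; apply: eq_tlift => a b.
by rewrite swZr; apply: eq_tlift => c d; rewrite -scalerA.
Qed.

Lemma dual_comul1' :
  \sw_(a, b <- comul (1 : D)) \sw_(c, d <- comul (1 : D)) (a ⊗ (c * b) ⊗ d) =
  \sw_(a, b <- comul 1) \sw_(c, d <- comul b) (a ⊗ c ⊗ d).
Proof.
apply: (dual_comul1_gen (op := fun b c => c * b)) => x y z; rewrite (wh_counit' wH).
transitivity (\sw_(a, b <- comul (1 : D)) \sw_(p, q <- comul y) \sw_(c, d <- comul (1 : D))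
  ⟨a|x⟩ *: (⟨b|q⟩ *: (⟨c|p⟩ *: (⟨d|z⟩ : K^o)))).
  apply: eq_tlift => a b; rewrite [RHS]tlift_exchange; apply: eq_tlift => c d.
  rewrite /p3 dpair_mul swZl swZr; apply: eq_tlift => p q.
  by rewrite -scalerA [in RHS](scalerA ⟨b|q⟩) [⟨b|q⟩ * _]mulrC -scalerA.
rewrite tlift_exchange; apply: eq_tlift => p q.
rewrite -!dual_oneE -!sw_dual_comul swZl; apply: eq_tlift => a b.
by rewrite swZr; apply: eq_tlift => c d; rewrite -scalerA.
Qed.

Let dual_counit3 phi psi chi : counit (phi * psi * chi) =
  \sw_(a, b <- comul (1 : H)) \sw_(c, d <- comul b)
    ⟨phi|a⟩ *: (⟨psi|c⟩ *: (⟨chi|d⟩ : K^o)).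
Proof.
rewrite dual_counitE -mulrA dpair_mul; apply: eq_tlift => a b.
by rewrite dpair_mul swZr.
Qed.

Lemma dual_counitM phi psi chi : counit (phi * psi * chi) =
  \sw_(a, b <- comul psi) (counit (phi * a) : K) *: counit (b * chi).
Proof.
rewrite dual_counit3.
rewrite -(sw_comul1 wH (f := fun a c d => ⟨phi|a⟩ *: (⟨psi|c⟩ *: (⟨chi|d⟩ : K^o))));
  try by linearity.
transitivity (\sw_(p, q <- comul (1 : H)) \sw_(a, b <- comul psi) \sw_(r, s <- comul (1 : H))
  ⟨phi|p⟩ *: (⟨a|q⟩ *: (⟨b|r⟩ *: (⟨chi|s⟩ : K^o)))).
  apply: eq_tlift => p q; rewrite [RHS]tlift_exchange; apply: eq_tlift => r s.
  rewrite -sw_dual_comul swZl swZr; apply: eq_tlift => a b.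
  by rewrite -scalerA.
rewrite tlift_exchange; apply: eq_tlift => a b.
rewrite !dual_counitE !dpair_mul swZl; apply: eq_tlift => p q.
by rewrite swZr; apply: eq_tlift => r s; rewrite -scalerA.
Qed.

Lemma dual_counitM' phi psi chi : counit (phi * psi * chi) =
  \sw_(a, b <- comul psi) (counit (phi * b) : K) *: counit (a * chi).
Proof.
rewrite dual_counit3.
rewrite -(sw_comul1' wH (f := fun a c d => ⟨phi|a⟩ *: (⟨psi|c⟩ *: (⟨chi|d⟩ : K^o))));
  try by linearity.
transitivity (\sw_(p, q <- comul (1 : H)) \sw_(a, b <- comul psi) \sw_(r, s <- comul (1 : H))
  ⟨phi|p⟩ *: (⟨b|q⟩ *: (⟨a|r⟩ *: (⟨chi|s⟩ : K^o)))).
  apply: eq_tlift => p q; rewrite [RHS]tlift_exchange; apply: eq_tlift => r s.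
  rewrite -sw_dual_comul swZl swZr; apply: eq_tlift => a b.
  by rewrite -scalerA [in RHS](scalerA ⟨b|q⟩) [⟨b|q⟩ * _]mulrC -scalerA.
rewrite tlift_exchange; apply: eq_tlift => a b.
rewrite !dual_counitE !dpair_mul swZl; apply: eq_tlift => p q.
by rewrite swZr; apply: eq_tlift => r s; rewrite -scalerA.
Qed.

(** Transposition exchanges product and coproduct and carries S to the dual antipode, so [epss] is
    its own transpose. The antipode axioms of the dual rest on this. *)
Lemma dpair_epss phi x : ⟨epss phi|x⟩ = ⟨phi|epss x⟩.
Proof.
rewrite /epss dpair_sw dpairr_sw.
transitivity (\sw_(a, b <- comul phi) \sw_(p, q <- comul x)
  ⟨a|S p⟩ *: (⟨b|q⟩ : K^o)).
  apply: (eq_tlift (W := K^o)) => a b; rewrite dpair_mul; apply: (eq_tlift (W := K^o)) => p q.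
  by rewrite dual_antipodeE.
by rewrite tlift_exchange; apply: (eq_tlift (W := K^o)) => p q; rewrite sw_dual_comul.
Qed.

Lemma dpair_epst phi x : ⟨epst phi|x⟩ = ⟨phi|epst x⟩.
Proof.
rewrite /epst dpair_sw dpairr_sw.
transitivity (\sw_(a, b <- comul phi) \sw_(p, q <- comul x)
  ⟨a|p⟩ *: (⟨b|S q⟩ : K^o)).
  apply: (eq_tlift (W := K^o)) => a b; rewrite dpair_mul; apply: (eq_tlift (W := K^o)) => p q.
  by rewrite dual_antipodeE.
by rewrite tlift_exchange; apply: (eq_tlift (W := K^o)) => p q; rewrite sw_dual_comul.
Qed.

Lemma dual_antipodel phi : \sw_(a, b <- comul phi) antipode a * b =
  \sw_(a, b <- comul 1) (counit (phi * b) : K) *: a.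
Proof.
apply: dualP => x; rewrite -/(epss phi) dpair_epss /epss (wh_antipodel wH).
rewrite dpairr_sw dpair_sw.
transitivity (\sw_(a, b <- comul (1 : D)) \sw_(p, q <- comul (1 : H))
    ⟨phi|p⟩ *: (⟨a|x⟩ *: (⟨b|q⟩ : K^o))).
  rewrite tlift_exchange; apply: (eq_tlift (W := K^o)) => p q; rewrite dpairZr -dual_oneE.
  rewrite mulrC -[LHS]/(⟨phi|p⟩ *: (⟨1|x * q⟩ : K^o)) -sw_dual_comul swZr.
  by apply: (eq_tlift (W := K^o)).
apply: (eq_tlift (W := K^o)) => a b; rewrite dpairZl dual_counitE dpair_mul.
rewrite -[RHS]/((_ : K^o) *: (⟨a|x⟩ : K^o)) swZl.
apply: (eq_tlift (W := K^o)) => p q; rewrite !scalerA; rewrite -scalerA [RHS]mulrC; exact: mulrCA.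
Qed.

Lemma dual_antipoder phi : \sw_(a, b <- comul phi) a * antipode b =
  \sw_(a, b <- comul 1) (counit (a * phi) : K) *: b.
Proof.
apply: dualP => x; rewrite -/(epst phi) dpair_epst /epst (wh_antipoder wH).
rewrite dpairr_sw dpair_sw.
transitivity (\sw_(a, b <- comul (1 : D)) \sw_(p, q <- comul (1 : H))
    ⟨phi|q⟩ *: (⟨a|p⟩ *: (⟨b|x⟩ : K^o))).
  rewrite tlift_exchange; apply: (eq_tlift (W := K^o)) => p q; rewrite dpairZr -dual_oneE.
  rewrite mulrC -[LHS]/(⟨phi|q⟩ *: (⟨1|p * x⟩ : K^o)) -sw_dual_comul swZr.
  by apply: (eq_tlift (W := K^o)).
apply: (eq_tlift (W := K^o)) => a b; rewrite dpairZl dual_counitE dpair_mul.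
rewrite -[RHS]/((_ : K^o) *: (⟨b|x⟩ : K^o)) swZl.
apply: (eq_tlift (W := K^o)) => p q; rewrite !scalerA; congr (_ *: _); exact: mulrC.
Qed.

Lemma dual_antipode_mid phi :
  \sw_(a, b <- comul phi) \sw_(c, d <- comul a) antipode c * d * antipode b =
  antipode phi.
Proof.
apply: dualP => x; rewrite dual_antipodeE -(wh_antipode_mid wH) dpair_sw dpairr_sw.
transitivity (\sw_(a, b <- comul phi) \sw_(p, q <- comul x)
    ⟨epss a|p⟩ *: (⟨b|S q⟩ : K^o)).
  apply: (eq_tlift (W := K^o)) => a b; rewrite -(lin_tlift (F := fun u => u * _)); last by linearity.
  by rewrite dpair_mul; apply: (eq_tlift (W := K^o)) => p q; rewrite dual_antipodeE.
rewrite tlift_exchange; apply: (eq_tlift (W := K^o)) => p q.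
under eq_tlift => a b do rewrite dpair_epss.
rewrite sw_dual_comul; congr ⟨_|_⟩; rewrite /epss.
by rewrite (lin_tlift (F := fun u => u * _)) //; linearity.
Qed.

Lemma dual_weak_hopf : weak_hopf D.
Proof.
split.
- exact: dual_comulM.
- exact: dual_comul1.
- exact: dual_comul1'.
- exact: dual_counitM.
- exact: dual_counitM'.
- exact: dual_antipodel.
- exact: dual_antipoder.
- exact: dual_antipode_mid.
Qed.

Hypothesis S_surj : forall x, exists y, S y = x.

Lemma dual_antipode_surj phi : exists psi, antipode psi = phi.
Proof.
exists (phi \o antipode_inv H)%VF; apply: dualP => x.
by rewrite dual_antipodeE /dpair comp_lfunE antipodeK.
Qed.

End Dual.

(** * The actions, and integrals seen from the dual *)

Section DualActions.
Variables (K : numClosedFieldType) (H : preHopfType K).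
Implicit Types (x y z : H) (phi psi : dual H).

Lemma coactl_ev x phi : coactl (ev x) phi = actl x phi.
Proof.
apply: dualP => y; rewrite actlE -sw_dual_comul dpair_sw.
by apply: (eq_tlift (W := K^o)) => a b; rewrite dpairZl evE mulrC.
Qed.

Lemma coactr_ev phi x : coactr phi (ev x) = actr phi x.
Proof.
apply: dualP => y; rewrite actrE -sw_dual_comul dpair_sw.
by apply: (eq_tlift (W := K^o)) => a b; rewrite dpairZl evE.
Qed.

Lemma hatA_LE : hatA_L H = A_L (dual H).
Proof.
apply/vspaceP => phi; apply/memv_imgP/A_LP => [[x _ ->]|[Phi ->]].
  by exists (ev x); rewrite lfunE /= /hepsL coactr_ev.
by have [x ->] := ev_surj Phi; exists x; rewrite ?memvf // lfunE /= /hepsL coactr_ev.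
Qed.

Lemma hatA_RE : hatA_R H = A_R (dual H).
Proof.
apply/vspaceP => phi; apply/memv_imgP/A_RP => [[x _ ->]|[Phi ->]].
  by exists (ev x); rewrite lfunE /= /hepsR coactl_ev.
by have [x ->] := ev_surj Phi; exists x; rewrite ?memvf // lfunE /= /hepsR coactl_ev.
Qed.

Lemma E_hatE x : E_ x = hatE_ (ev x).
Proof. by apply/funext => phi; rewrite /hatE_ coactl_ev. Qed.

Lemma dpair_coactl phi psi x : ⟨phi|coactl psi x⟩ = ⟨phi * psi|x⟩.
Proof.
rewrite dpairr_sw dpair_mul; apply: (eq_tlift (W := K^o)) => a b.
by rewrite dpairZr mulrC.
Qed.

Lemma dpair_coactr phi psi x : ⟨phi|coactr x psi⟩ = ⟨psi * phi|x⟩.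
Proof.
rewrite dpairr_sw dpair_mul; apply: (eq_tlift (W := K^o)) => a b.
by rewrite dpairZr.
Qed.

Lemma coactlM phi psi x : coactl (phi * psi) x = coactl phi (coactl psi x).
Proof. by apply: dual_sep => chi; rewrite !dpair_coactl mulrA. Qed.

Hypothesis wH : weak_hopf H.

(** Pairing λ ⇀ x with φ gives ⟨φλ|x⟩ = ⟨epst(φ)λ|x⟩; moving [epst] across the pairing shows λ ⇀ x =
    ⟨λ|x_(2)⟩ epst(x_(1)). *)
Lemma left_integral_coactl lam x : left_integral lam -> coactl lam x \in A_L H.
Proof.
move=> hlam.
have -> : coactl lam x = \sw_(a, b <- comul x) ⟨lam|b⟩ *: epst a.
  apply: dual_sep => phi; rewrite dpair_coactl hlam -/(epst phi) dpair_mul dpairr_sw.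
  by apply: (eq_tlift (W := K^o)) => a b; rewrite dpair_epst dpairZr mulrC.
by apply: memv_suml => i _; apply: memv_suml => j _; rewrite !memvZ // epst_A_L.
Qed.

Lemma left_integral_actl l phi : left_integral l -> actl l phi \in hatA_L H.
Proof.
move=> hl; apply/memv_imgP.
(* The witness is read off from ⟨φ|x l⟩ = ⟨φ|epst(x) l⟩ = ε(1_(1) x) ⟨φ|1_(2) l⟩. *)
exists (\sw_(a, b <- comul 1) ⟨phi|b * l⟩ *: a); rewrite ?memvf //.
apply: dualP => x; rewrite lfunE /= actlE actrE dual_oneE hl.
rewrite (wh_antipoder wH) (lin_tlift (F := fun u : H => ⟨phi|u * l⟩ : K^o)); last by linearity.
rewrite (lin_tlift (F := fun u : H => counit (u * x))); last by linearity.
apply: (eq_tlift (W := K^o)) => a b.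
by rewrite -!scalerAl dpairZr linearZ /= mulrC.
Qed.

(** ⟨λ|x l⟩ = ⟨λ|epst(x) l⟩ = ε(E(epst(x) l)) = ε(epst(x) E(l)) = ε(epst x) = ε(x). *)
Lemma actl_dual_pair (l : H) (lam : dual H) : left_integral l -> left_integral lam ->
  dual_pair l lam -> actl l lam = 1.
Proof.
move=> hl hlam l_lam; apply: dualP => x; rewrite actlE hl -/(epst x).
rewrite -counit_hatE hatE_A_Ll ?epst_A_L // /hatE_ l_lam mulr1 dual_oneE.
by have := counit_epst wH 1 x; rewrite !mul1r.
Qed.

(** * From the hypercenter of the dual to that of H *)

Section Hypercenter.
Variable c : dual H.
Hypothesis cZ : c \in (hatA_L H :&: hatA_R H :&: 'Z({:dual H}))%VS.

Let cL : exists x, c = epsL x.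
Proof.
by move: cZ; rewrite !memv_cap => /andP[/andP[/memv_imgP[x _ ->] _] _]; exists x; rewrite lfunE.
Qed.

Let cR : exists x, c = epsR x.
Proof.
by move: cZ; rewrite !memv_cap => /andP[/andP[_ /memv_imgP[x _ ->]] _]; exists x; rewrite lfunE.
Qed.

Lemma hypercenter_comm phi : c * phi = phi * c.
Proof.
by move: cZ; rewrite !memv_cap => /and3P[_ _ /centvP]; apply; rewrite memvf.
Qed.

Lemma hypercenter_coact x : coactl c x = coactr x c.
Proof.
by apply: dual_sep => phi; rewrite dpair_coactl dpair_coactr hypercenter_comm.
Qed.

Lemma hypercenter_heps : hepsR c = hepsL c.
Proof. exact: hypercenter_coact. Qed.

(** For c = [epsR a], the counit axiom splits ⟨c|x⟩ = ε(x 1 a) into ε(x 1_(1)) ε(1_(2) a), whose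
    second factor is ⟨c|1_(2)⟩. *)
Lemma hypercenter_epsR : c = epsR (hepsR c).
Proof.
have [a ca] := cR; apply: dualP => x; rewrite actlE dual_oneE.
rewrite -[in LHS](mulr1 x) {1}ca actlE dual_oneE (wh_counit wH).
rewrite /hepsR /coactl (lin_tlift (F := fun u : H => counit (x * u))); last by linearity.
apply: (eq_tlift (W := K^o)) => p q; rewrite -scalerAr linearZ /= {1}ca actlE dual_oneE.
exact: mulrC.
Qed.

Lemma hypercenter_epsL : c = epsL (hepsL c).
Proof.
have [a ca] := cL; apply: dualP => x; rewrite actrE dual_oneE.
rewrite -[in LHS](mul1r x) {1}ca actrE dual_oneE mulrA (wh_counit wH).
rewrite /hepsL /coactr (lin_tlift (F := fun u : H => counit (u * x))); last by linearity.
by apply: (eq_tlift (W := K^o)) => p q; rewrite -scalerAl linearZ /= {1}ca actrE dual_oneE.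
Qed.

Lemma hepsL_hypercenter_A_L : hepsL c \in A_L H.
Proof. by apply/A_LP; exists c. Qed.

Lemma hepsL_hypercenter_A_R : hepsL c \in A_R H.
Proof. by apply/A_RP; exists c; rewrite hypercenter_heps. Qed.

Lemma coactl_hypercenter x : coactl c x = x * hepsL c.
Proof.
rewrite -(counit_A_Rr wH) ?hepsL_hypercenter_A_R //; apply: eq_tlift => a b.
by rewrite {1}hypercenter_epsR hypercenter_heps actlE dual_oneE.
Qed.

(** Centrality of c says c ⇀ x = x ↼ c. The left action multiplies x by [hepsL c] on the right, the
    right action on the left. *)
Lemma hepsL_hypercenter_comm x : hepsL c * x = x * hepsL c.
Proof.
rewrite -coactl_hypercenter hypercenter_coact.
rewrite -(counit_A_Ll wH) ?hepsL_hypercenter_A_L //; apply: eq_tlift => a b.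
by rewrite {2}hypercenter_epsL actrE dual_oneE.
Qed.

Lemma hepsL_hypercenter_mem :
  hepsL c \in (A_L H :&: A_R H :&: 'Z({:H}))%VS.
Proof.
rewrite !memv_cap hepsL_hypercenter_A_L hepsL_hypercenter_A_R memvf /=.
by apply/centvP => x _; exact: hepsL_hypercenter_comm.
Qed.

End Hypercenter.

End DualActions.

(** * The normalized integral and its index *)

Section Normalization.
Variables (K : numClosedFieldType) (H : preHopfType K) (wH : weak_hopf H).
Hypothesis S_surj : forall x : H, exists y, antipode y = x.
Variables (l : H) (lam : dual H).
Hypotheses (hl : left_integral l) (hlam : left_integral lam)
  (lam_nondeg : hat_nondegenerate_int lam) (l_lam : dual_pair l lam)
  (l_norm : normalized_int l).
Local Notation c := (nR lam).
Hypotheses (c_unit : c \is a GRing.unit)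
  (cZ : c \in (hatA_L H :&: hatA_R H :&: 'Z({:dual H}))%VS).

Let mu : dual H := c^-1 * lam.
Let z := hepsL c.

Let c_mu : c * mu = lam. Proof. exact: mulVKr. Qed.

Lemma hatE_normalized x : hatE_ lam x = z * hatE_ mu x.
Proof.
by rewrite -c_mu /hatE_ coactlM (coactl_hypercenter wH cZ) -(hepsL_hypercenter_comm wH cZ).
Qed.

Let lam_mu x : ⟨lam|x⟩ = ⟨mu|z * x⟩.
Proof.
rewrite -[in LHS]c_mu -dpair_coactr -hypercenter_coact //.
by rewrite (coactl_hypercenter wH cZ) (hepsL_hypercenter_comm wH cZ).
Qed.

Lemma left_integral_normalized : left_integral mu.
Proof.
have cV phi : phi * c^-1 = c^-1 * phi.
  by apply: commrV; exact: esym (hypercenter_comm cZ phi).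
by move=> phi; rewrite /mu !mulrA !cV -!mulrA hlam.
Qed.

Lemma nondegenerate_normalized : hat_nondegenerate_int mu.
Proof.
split=> x mu0; [apply: lam_nondeg.1 | apply: lam_nondeg.2] => y; rewrite lam_mu.
  by rewrite mulrA (hepsL_hypercenter_comm wH cZ) -mulrA mu0.
by rewrite mulrA mu0.
Qed.

Lemma epst_normalized : epst mu = 1.
Proof.
have wD := dual_weak_hopf wH; have sD := dual_antipode_surj S_surj.
have [cL cR] : c \in A_L (dual H) /\ c \in A_R (dual H).
  by rewrite -hatA_LE -hatA_RE; move: cZ; rewrite !memv_cap => /andP[/andP[]].
have cE := epst_A_Ll wD mu cL.
rewrite c_mu -(antipode_nR wD sD) (antipode_A_LR wD cL cR) in cE.
by apply: (mulrI c_unit); rewrite mulr1 -cE.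
Qed.

(** Transposed, epst μ = 1 says that w = μ ⇀ 1 satisfies ε(w x) = ε(x) for all x. As w lies in A_L,
    w = ε(w 1_(1)) 1_(2) = ε(1_(1)) 1_(2) = 1. *)
Lemma normalized_normalized : hat_normalized_int mu.
Proof.
have wA : coactl mu 1 \in A_L H.
  by apply: left_integral_coactl => //; exact: left_integral_normalized.
have counit_mu x : counit (coactl mu 1 * x) = counit x.
  rewrite /coactl (lin_tlift (F := fun u : H => counit (u * x))); last by linearity.
  rewrite -dual_oneE -epst_normalized dpair_epst /epst (wh_antipoder wH) dpairr_sw.
  by apply: (eq_tlift (W := K^o)) => a b; rewrite -scalerAl linearZ dpairZr /= mulrC.
rewrite /hat_normalized_int -[LHS]mulr1 -(counit_A_Ll wH) // -[RHS]counitl.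
by apply: eq_tlift => a b; rewrite counit_mu.
Qed.

Lemma hatInd_normalized : hatInd mu = z.
Proof.
(* Normalization of l says that [epsR l] is the counit, and [nR l] is [hepsR] of it. *)
have nRl : nR l = 1.
  rewrite (nR_hepsR wH) // /epsR l_norm -[RHS]counitr.
  by apply: eq_tlift => a b; rewrite dual_oneE.
apply: watatani_indexE.
have [|n [u [v [uv nR_uv]]]] := hatE_is_index wH S_surj hl _ lam_nondeg.2 l_lam.
  by move=> x; apply: left_integral_coactl.
exists n, (fun i => z * u i), v; split=> [b|].
  have [uv1 uv2] := uv b; split.
    rewrite -[RHS]uv1; apply: eq_bigr => i _.
    by rewrite hatE_normalized mulrA (hepsL_hypercenter_comm wH cZ).
  rewrite -[RHS]uv2; apply: eq_bigr => i _; rewrite hatE_normalized.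
  rewrite mulrA -(hepsL_hypercenter_comm wH cZ) -mulrA (hatE_A_Ll wH) //.
  exact: hepsL_hypercenter_A_L.
rewrite -[LHS]mulr1 -nRl nR_uv mulr_sumr.
by apply: eq_bigr => i _; rewrite mulrA.
Qed.

End Normalization.

Theorem proposition2p6p10 (R : realType) (A : weakCstarHopfType R[i])
  (l : A) (lam : dual A)
  (hl : left_integral l) (hlam : left_integral lam)
  (l_nondeg : nondegenerate_int l) (lam_nondeg : hat_nondegenerate_int lam)
  (l_lam_dual : dual_pair l lam) :
  (* (i) *)
  (index_finite_type (hatA_L A) (E_ l) /\
   tensor_quasi_basis (E_ l) (qb_tensor lam)) /\
  (* (ii) *)
  (index_finite_type (A_L A) (hatE_ lam) /\
   tensor_quasi_basis (hatE_ lam) (qb_tensor l)) /\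
  (* (iii) *)
  (Ind l = nR lam /\ Ind l \in (hatA_R A :&: 'Z({:dual A}))%VS /\
   hatInd lam = nR l /\ hatInd lam \in (A_R A :&: 'Z({:A}))%VS) /\
  (* (iv) *)
  (normalized_int l -> Ind l \is a GRing.unit ->
   Ind l \in (hatA_L A :&: hatA_R A :&: 'Z({:dual A}))%VS ->
   let lamd : dual A := (nR lam)^-1 * lam in
   (left_integral lamd /\ hat_nondegenerate_int lamd /\ hat_normalized_int lamd) /\
   (forall a : A, hatE_ lam a = hatInd lamd * hatE_ lamd a) /\
   hatInd lamd \in (A_L A :&: A_R A :&: 'Z({:A}))%VS /\
   (hatInd lamd = hepsL (Ind l) /\ Ind l = epsL (hatInd lamd)) /\
   (hatInd lamd = hepsR (Ind l) /\ Ind l = epsR (hatInd lamd))).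
Proof.
have wA := cstar_weak_hopf A; have wD := dual_weak_hopf wA.
have sA := @cstar_antipode_surj _ A; have sD := dual_antipode_surj sA.
have EA x : hatE_ lam x \in A_L A by exact: left_integral_coactl.
(* Obtained inside A from the left integral l, without treating [ev l] as an integral of the
   bidual. *)
have ED phi : hatE_ (ev l) phi \in A_L (dual A).
  by rewrite -E_hatE -hatA_LE; exact: left_integral_actl.
have lamN x : (forall y, ⟨lam|y * x⟩ = 0) -> x = 0 by exact: lam_nondeg.2.
have lN phi : (forall psi, ⟨ev l|psi * phi⟩ = 0) -> phi = 0.
  by move=> l0; apply: l_nondeg.2 => psi; rewrite -evE.
have lam_l : hatE_ (ev l) lam = 1 by rewrite -E_hatE; exact: actl_dual_pair.
have IndE : Ind l = nR lam.
  by rewrite /Ind E_hatE; exact: (hatIndE wD sD hlam ED lN lam_l).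
have hatIE := hatIndE wA sA hl EA lamN l_lam_dual.
split.
  rewrite E_hatE hatA_LE; split.
    exact: (hatE_index_finite wD sD hlam ED lN lam_l).
  exact: (hatE_quasi_basis wD sD hlam ED lN lam_l).
split.
  split; first exact: (hatE_index_finite wA sA hl EA lamN l_lam_dual).
  exact: (hatE_quasi_basis wA sA hl EA lamN l_lam_dual).
split.
  rewrite IndE hatIE hatA_RE; split=> //.
  split; first exact: (nR_mem wD sD hlam ED lN lam_l).
  split=> //; exact: (nR_mem wA sA hl EA lamN l_lam_dual).
rewrite IndE => l_norm c_unit cZ lamd.
have lamdE : hatInd lamd = hepsL (nR lam) by exact: hatInd_normalized.
rewrite lamdE; split.
  split; first exact: left_integral_normalized.
  split; first exact: nondegenerate_normalized.
  exact: normalized_normalized.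
split; first by move=> a; exact: hatE_normalized.
split; first exact: hepsL_hypercenter_mem.
split; split=> //; first exact: hypercenter_epsL.
  by rewrite hypercenter_heps.
by rewrite -hypercenter_heps //; exact: hypercenter_epsR.
Qed.
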